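(* For every $\beta > 0$ and $\delta > 0$ there is $C > 0$ (depending only on $\beta$ and $\delta$) so that the following holds for every positive integer $n$. Let $B \subseteq \{\pm 1\}^n$ be of size $|B| = 2^{\beta n}$. Let $Y$ be uniformly distributed in $B$. Let $A \subset \mathbb{Z}^n$ be a two-cube. Then, for all but at most $2^{n(1-\beta+\delta)}$ directions $x \in A$, $$\mathbb{E}_{\theta}\left[\, \left| \mathbb{E}_Y\left[ \exp(2\pi i \theta \cdot \langle x, Y\rangle) \right] \right| \,\right] \leq \mu_C(A),$$ where $\theta$ is uniformly distributed in $[0,1]$, independently of $Y$.
   Context: $\langle x, y\rangle = \sum_{j=1}^n x_j y_j$. A set $A \subset \mathbb{Z}^n$ is a two-cube if $A = A_1 \times \cdots \times A_n$, where each $A_j = \{u_j, v_j\}$ consists of two distinct integers. Its differences are $d_j = u_j - v_j$ for $j \in [n] = \{1,\ldots,n\}$. For an integer $\ell > 0$, $r_\ell(A)$ is the number of elements $(\epsilon, j) \in \{\pm 1\}^{2\ell} \times [n]^{2\ell}$ that satisfy $\epsilon_1 d_{j_1} + \cdots + \epsilon_{2\ell} d_{j_{2\ell}} = 0$. For $C > 0$ and an integer $\ell > 0$ define $$R_{C,\ell}(A) = \frac{C^\ell\, r_\ell(A)}{n^{2\ell + 1/2}} + \exp\left(-\tfrac{n}{C}\right), \qquad R_C(A) = \inf\{ R_{C,\ell}(A) : \ell \geq 1 \text{ an integer}\}.$$ Define $$\mu_C(A) = \inf\left\{ \mu \in [0,1] : \exists\, \nu \in (0,1] \ \text{ such that }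 \ \mu^{(1+\nu)^2} \geq 3 \exp\left(-\tfrac{\nu n}{C}\right) + \frac{R_C(A)}{50\sqrt{\nu}} \right\},$$ with the convention that the infimum of the empty set is $1$. *)

(* Defs.v *)
From HB Require Import structures.
From mathcomp Require Import all_boot all_order all_algebra.
From mathcomp Require Import finmap complex.
From mathcomp Require Import all_classical all_reals all_analysis.

Set Implicit Arguments.
Unset Strict Implicit.
Unset Printing Implicit Defensive.

Import Order.TTheory GRing.Theory Num.Theory.
Import numFieldNormedType.Exports.

Local Open Scope classical_set_scope.
Local Open Scope fset_scope.
Local Open Scope ring_scope.

(* {-1, 1} is encoded by bool through b |-> (-1) ^+ b, so that {-1, 1}^n is
   the finite type {ffun 'I_n -> bool}. *)
Definition sign_cube (n : nat) := {ffun 'I_n -> bool}.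

Definition sign_vec (n : nat) (y : sign_cube n) : {ffun 'I_n -> int} :=
  [ffun j => (-1) ^+ y j].

Definition dotz (n : nat) (x y : {ffun 'I_n -> int}) : int :=
  \sum_j x j * y j.

(* The sides are A_j = {cube_u j, cube_v j}.  The labelling of the two
   elements of A_j only affects the sign of the j-th difference. *)
Record two_cube (n : nat) := TwoCube {
  cube_u : {ffun 'I_n -> int};
  cube_v : {ffun 'I_n -> int};
  cube_neq : forall j, cube_u j != cube_v j }.

Section TwoCube.
Variables (n : nat) (A : two_cube n).

Definition cube_vertex (b : {ffun 'I_n -> bool}) : {ffun 'I_n -> int} :=
  [ffun j => if b j then cube_u A j else cube_v A j].

(* The product A_1 x ... x A_n as a finite set; see [in_cube_points]. *)
Definition cube_points : {fset {ffun 'I_n -> int}} :=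
  [fset cube_vertex b | b in [set: {ffun 'I_n -> bool}]%SET].

Lemma in_cube_points (x : {ffun 'I_n -> int}) :
  x \in cube_points = [forall j, (x j == cube_u A j) || (x j == cube_v A j)].
Proof.
apply/imfsetP/forallP => [[b _ ->] j|xA].
  by rewrite ffunE; case: (b j); rewrite eqxx ?orbT.
exists [ffun j => x j == cube_u A j] => //.
  by rewrite inE.
apply/ffunP => j; rewrite !ffunE.
by have := xA j; case: eqVneq => //= _ /eqP.
Qed.

Definition cube_diff (j : 'I_n) : int := cube_u A j - cube_v A j.

Definition r_count (l : nat) : nat :=
  #|[set p : {ffun 'I_(2 * l) -> bool} * {ffun 'I_(2 * l) -> 'I_n} |
      \sum_(k < 2 * l) (-1) ^+ p.1 k * cube_diff (p.2 k) == 0]%SET|.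

Variables (R : realType) (C : R).

Definition R_Cl (l : nat) : R :=
  C ^+ l * (r_count l)%:R / n%:R `^ ((2 * l)%:R + 2^-1) + expR (- (n%:R / C)).

Definition R_C : R := inf [set R_Cl l | l in [set l | (1 <= l)%N]].

Definition mu_C_set : set R :=
  [set mu | 0 <= mu <= 1 /\
     exists nu : R, 0 < nu <= 1 /\
       mu `^ ((1 + nu) ^+ 2) >=
         3 * expR (- (nu * n%:R / C)) + R_C / (50 * Num.sqrt nu)].

(* [inf] of the empty set is 0 in the library; here it has to be 1. *)
Definition mu_C : R := if `[< mu_C_set !=set0 >] then inf mu_C_set else 1.

End TwoCube.

Section CharacteristicFunction.
Variable R : realType.

(* exp(i * t), for t real *)
Definition cis (t : R) : R[i] := Complex (cos t) (sin t).

(* The expectation of f(Y), for Y uniformly distributed in B *)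
Definition unif_mean (n : nat) (B : {set sign_cube n})
    (f : sign_cube n -> R[i]) : R[i] :=
  (\sum_(y in B) f y) / #|B|%:R.

Definition char_abs (n : nat) (B : {set sign_cube n})
    (x : {ffun 'I_n -> int}) (theta : R) : R :=
  ComplexField.Normc.normc
    (unif_mean B (fun y => cis (2 * pi * theta * (dotz x (sign_vec y))%:~R))).

(* The outer expectation, over theta uniform in [0, 1] *)
Definition mean_char_abs (n : nat) (B : {set sign_cube n})
    (x : {ffun 'I_n -> int}) : \bar R :=
  'E_(uniform_prob (@ltr01 R))[char_abs B x].

End CharacteristicFunction.

(* Main.v *)
Require Import Defs.
From mathcomp Require Import all_boot all_order all_algebra.
From mathcomp Require Import finmap complex.
From mathcomp Require Import all_classical all_reals all_analysis.
From mathcomp Require Import measurable_realfun.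
From mathcomp Require Import ring lra.

(** The proof bounds a sum over two independent sources. Let S be the set of
    exceptional directions x and suppose that it is too large, so that
    #|S| * #|B| >= 2 `^ (n * (1 + delta)). Let X be uniform in S and Y uniform
    in B. If mu is admissible in the definition of mu_C, with parameter nu, and
    is smaller than the mean over theta of the characteristic function for every
    x in S, a contradiction follows from an upper bound
      (E_theta E_X |E_Y exp (2 pi i theta <X, Y>)|) `^ ((1 + nu) ^+ 2)
        <= 3 * exp (- nu n / C) + R_C / (50 * sqrt nu)
    (two_source_circle_mean). It has three ingredients.

    Decoupling, for a fixed theta (twisted_mean_bound, two_source_bound). The
    coordinates of Y are revealed from the first to the last and those of X from
    the last to the first. A coordinate which is not nearly determined by what
    was revealed before, both for X and for Y, is called free. At a coordinate
    j, the sum over the two signs of Y_j is a combination of two complex numbers,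
    and the two values of X_j rotate them relative to each other by angles which
    differ by 4 pi theta d_j. Hence for one of these values they are not aligned,
    or else they have very different moduli; in both cases the power 1 + nu of
    the modulus of the combination is smaller, by a factor
    1 - c nu sin^2 (2 pi theta d_j), than the mean of the powers of the moduli
    (two_point_gain, dephasing_gain). Multiplying these gains over the free
    coordinates and averaging over X, with Hoelder's inequality to pass from the
    random gains to their conditional expectations, gives
      (E_X |E_Y ...|) `^ ((1 + nu) ^+ 2)
        <= E_{X,Y} exp (- c nu * sum_{j free} sin^2 (2 pi theta d_j)).

    Entropy (entropy_past, entropy_future). The entropies of X and Y add up to
    at least (1 + delta) n, so that, outside an event of exponentially small
    probability, the numbers of coordinates free for X and free for Y add up to
    at least (1 + delta / 2) n, and at least delta / 2 * n coordinates are free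
    for both.

    Halasz's inequality (halasz). For a fixed set J of m >= delta / 2 * n
    coordinates, the mean over theta of exp (- a f), with f the sum over J of
    sin^2 (2 pi theta d_j), is small. The function sqrt f is subadditive and
    continuous, vanishes at 0 and is somewhere at least sqrt m / 2. So there are
    about sqrt (a m) translates of the sublevel set where a * f <= 1 which are
    nearly disjoint and contained in the set where f <= m / 4. The measure of
    the latter is at most r_l / m ^+ (2 * l), by Markov's inequality for the
    (2 * l)-th power of sum_J cos (4 pi theta d_j) = m - 2 f. *)

Import Order.TTheory GRing.Theory Num.Theory.
Import numFieldNormedType.Exports.
Local Open Scope fset_scope.
Local Open Scope ring_scope.

Set Implicit Arguments.
Unset Strict Implicit.
Unset Printing Implicit Defensive.

(** * Power inequalities *)

Section PowerInequalities.
Variable R : realType.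
Implicit Types a b c p r s t x nu lam : R.

Lemma powR_le1 (x t : R) : 0 <= x <= 1 -> 0 <= t -> x `^ t <= 1.
Proof.
move=> /andP[x0 x1] t0; have <- : 1 `^ t = 1 :> R by rewrite powR1.
by rewrite ge0_ler_powR ?nnegrE.
Qed.

Lemma sqrtr_quarter x : 0 <= x -> Num.sqrt (x / 4) = Num.sqrt x / 2.
Proof.
move=> x0; rewrite sqrtrM //; congr (_ * _).
rewrite -[RHS]ger0_norm ?invr_ge0 // -sqrtr_sqr; congr Num.sqrt.
by field.
Qed.

(** The convex function x |-> x `^ p lies above its tangent at c; the tangent being
    affine in a, this bound can be averaged, which is how Jensen's inequality is obtained
    both for finite means and for the mean over the circle. *)
Lemma tangent_powR p a c : 1 <= p -> 0 <= a -> 0 <= c ->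
  a * c `^ (p - 1) <= a `^ p / p + c `^ p * (1 - p^-1).
Proof.
rewrite le_eqVlt => /predU1P[<-|p1] a0 c0.
  by rewrite subrr powRr0 invr1 subrr mulr0 addr0 !mulr1 powRr1.
have p0 : 0 < p by lra.
have q0 : 0 < p / (p - 1) by rewrite divr_gt0 // subr_gt0.
have pq : p^-1 + (p / (p - 1))^-1 = 1.
  by rewrite invf_div -{1}[p^-1]mul1r -mulrDl addrC subrK divff ?gt_eqF.
have := conjugate_powR a0 (powR_ge0 c (p - 1)) p0 q0 pq.
rewrite -powRrM (_ : (p - 1) * (p / (p - 1)) = p); last first.
  by field; rewrite gt_eqF // subr_gt0.
by have /eqP <- : (1 - p^-1 == (p / (p - 1))^-1); first by rewrite subr_eq addrC pq.
Qed.

Lemma jensen_powR (I : finType) (w f : I -> R) (p : R) : 1 <= p ->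
  (forall i, 0 <= w i) -> \sum_i w i = 1 -> (forall i, 0 <= f i) ->
  (\sum_i w i * f i) `^ p <= \sum_i w i * f i `^ p.
Proof.
move=> p1 w0 w1 f0; set M := \sum_i w i * f i.
have M0 : 0 <= M by apply: sumr_ge0 => i _; rewrite mulr_ge0.
have p0 : 0 < p by lra.
have : \sum_i w i * (f i * M `^ (p - 1)) <=
       \sum_i w i * (f i `^ p / p + M `^ p * (1 - p^-1)).
  by apply: ler_sum => i _; rewrite ler_wpM2l // tangent_powR.
under eq_bigr do rewrite mulrA.
under [X in _ <= X]eq_bigr do rewrite mulrDr mulrA.
rewrite -mulr_suml big_split /= -!mulr_suml w1 mul1r mulr_powRB1 //.
rewrite -/M; set S := \sum_i w i * f i `^ p => le1.
have : M `^ p / p <= S / p by lra.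
by rewrite ler_pM2r // invr_gt0.
Qed.

(** From a `^ nu >= 1 + nu * ln a and ln t >= 1 - t^-1, with a = t ^+ 2. Averaged
    over a distribution of mean 1 it shows that the (1 + nu)-th moment exceeds 1
    by at least nu times the mean of (t - 1) ^+ 2. *)
Lemma sqr_powR_tangent t nu : 0 <= t -> 0 <= nu ->
  t ^+ 2 + 2 * nu * (t ^+ 2 - t) <= (t ^+ 2) `^ (1 + nu).
Proof.
rewrite le_eqVlt => /predU1P[<- _|t0 nu0].
  by rewrite expr0n /= subrr mulr0 addr0 powR_ge0.
have t2 : t ^+ 2 != 0 by rewrite gt_eqF // exprn_gt0.
rewrite powRD ?t2 ?implybT // powRr1 ?sqr_ge0 //.
have -> : (t ^+ 2) `^ nu = expR (2 * nu * ln t).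
  by rewrite /powR gt_eqF ?exprn_gt0 // lnXn // -mulr_natl; congr expR; ring.
have lnt : 1 - t^-1 <= ln t.
  have := expR_ge1Dx (- ln t); rewrite expRN lnK ?posrE //; lra.
have : 1 + 2 * nu * (1 - t^-1) <= expR (2 * nu * ln t).
  apply: le_trans (expR_ge1Dx _); rewrite lerD2l ler_wpM2l //; lra.
move=> le1; rewrite (_ : t ^+ 2 + _ = t ^+ 2 * (1 + 2 * nu * (1 - t^-1))).
  by rewrite ler_wpM2l // sqr_ge0.
by field; rewrite gt_eqF.
Qed.

Lemma jensen_powR2 p a b r : 1 <= r -> 0 <= p <= 1 -> 0 <= a -> 0 <= b ->
  (p * a + (1 - p) * b) `^ r <= p * a `^ r + (1 - p) * b `^ r.
Proof.
move=> r1 /andP[p0 p1] a0 b0.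
have := @jensen_powR bool (fun i => if i then p else 1 - p)
  (fun i => if i then a else b) r r1.
rewrite !big_bool /=; apply; first by case=> //=; lra.
  by lra.
by case.
Qed.

(** Here r is the modulus of a sum of two complex numbers of moduli p * a and
    (1 - p) * b which fail to be aligned by an amount measured by s. If a * b is
    comparable to w ^+ 2, for w the weighted mean of a and b, misalignment makes
    r smaller than w. Otherwise a and b are far apart, and strict convexity of
    the power 1 + nu makes w `^ (1 + nu) smaller than the mean of the powers:
    this case is the reason for using an exponent above 1, and the gain is
    proportional to nu. *)
Lemma two_point_gain lam nu s p a b r :
  0 <= lam -> 0 < nu <= 1 -> 0 <= s <= 1 -> lam <= p -> lam <= 1 - p ->
  0 <= a -> 0 <= b -> 0 <= r ->
  r ^+ 2 <= (p * a + (1 - p) * b) ^+ 2 - p * (1 - p) * (a * b) * s ->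
  r `^ (1 + nu) <=
    (1 - lam / 32 * nu * s) * (p * a `^ (1 + nu) + (1 - p) * b `^ (1 + nu)).
Proof.
move=> lam0 /andP[nu0 nu1] /andP[s0 s1] lamp lamq a0 b0 r0.
set w := p * a + (1 - p) * b; set M := p * _ + _ => le_r.
have p01 : 0 <= p <= 1 by lra.
have w0 : 0 <= w by rewrite addr_ge0 // mulr_ge0 //; lra.
have lam2 : lam <= 1 / 2 by lra.
have leM : w `^ (1 + nu) <= M by apply: jensen_powR2 => //; lra.
have M0 : 0 <= M by apply: le_trans leM; rewrite powR_ge0.
have ab0 : 0 <= a * b by rewrite mulr_ge0.
have pq0 : lam / 2 <= p * (1 - p) by nra.
have ls : 0 <= lam * s <= 1 / 2 by apply/andP; split; nra.
have r_w : r <= w.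
  rewrite -(@ler_pXn2r _ 2) ?nnegrE //; apply: le_trans le_r _.
  by rewrite gerBl !mulr_ge0 //; lra.
have [big|small] := lerP (w ^+ 2 / 8) (a * b).
  (* 1 - lam * s / 32 is an upper bound for the root of 1 - lam * s / 16 *)
  have r_wg : r <= w * (1 - lam / 32 * s).
    rewrite -(@ler_pXn2r _ 2) ?nnegrE //; last by rewrite mulr_ge0 //; lra.
    apply: le_trans le_r _.
    have : lam / 2 * (w ^+ 2 / 8) * s <= p * (1 - p) * (a * b) * s.
      rewrite ler_wpM2r //; apply: ler_pM => //; first by lra.
      by rewrite mulr_ge0 ?sqr_ge0.
    rewrite exprMn => le1.
    have : 0 <= w ^+ 2 * (lam * s) ^+ 2 by rewrite mulr_ge0 ?sqr_ge0.
    nra.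
  have g01 : 0 < 1 - lam / 32 * s <= 1 by lra.
  apply: (@le_trans _ _ ((w * (1 - lam / 32 * s)) `^ (1 + nu))).
    by rewrite ge0_ler_powR ?nnegrE //; lra.
  rewrite powRM //; last by lra.
  apply: (@le_trans _ _ (M * (1 - lam / 32 * s))).
    apply: ler_pM; rewrite ?powR_ge0 //.
    by apply: ge1r_powR => //; lra.
  rewrite mulrC; apply: ler_wpM2r => //; nra.
have w_gt0 : 0 < w.
  rewrite lt_neqAle w0 andbT; apply: contraTneq small => <-.
  by rewrite expr0n /= mul0r -leNgt.
apply: (@le_trans _ _ (w `^ (1 + nu))).
  by rewrite ge0_ler_powR ?nnegrE //; lra.
pose u := Num.sqrt (a / w); pose v := Num.sqrt (b / w).
have u0 : 0 <= u by exact: sqrtr_ge0.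
have v0 : 0 <= v by exact: sqrtr_ge0.
have aE : a = w * u ^+ 2.
  by rewrite sqr_sqrtr ?divr_ge0 // mulrC divfK // gt_eqF.
have bE : b = w * v ^+ 2.
  by rewrite sqr_sqrtr ?divr_ge0 // mulrC divfK // gt_eqF.
have uv1 : p * u ^+ 2 + (1 - p) * v ^+ 2 = 1.
  apply: (@mulfI _ w); first by rewrite gt_eqF.
  by rewrite mulr1 {2}/w aE bE; ring.
have uv : (u * v) ^+ 2 < 1 / 8.
  rewrite -(@ltr_pM2l _ (w ^+ 2)) ?exprn_gt0 //.
  have <- : a * b = w ^+ 2 * (u * v) ^+ 2 by rewrite {1}aE {1}bE; ring.
  by move: small; lra.
(* One of u, v is at most 3 / 5, as otherwise (u * v) ^+ 2 >= (9 / 25) ^+ 2 > 1 / 8. *)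
have gap : lam / 8 <= p * (u - 1) ^+ 2 + (1 - p) * (v - 1) ^+ 2.
  have [uh|uh] := lerP u (3 / 5).
    have : 4 / 25 <= (u - 1) ^+ 2 by nra.
    have : 0 <= (v - 1) ^+ 2 by exact: sqr_ge0.
    nra.
  have vh : v <= 3 / 5.
    rewrite leNgt; apply/negP => vh.
    have uv_big : 9 / 25 <= u * v by nra.
    by move: uv uv_big; generalize (u * v) => z; nra.
  have : 4 / 25 <= (v - 1) ^+ 2 by nra.
  have : 0 <= (u - 1) ^+ 2 by exact: sqr_ge0.
  nra.
have leW : w `^ (1 + nu) * (1 + lam * nu / 8) <= M.
  have aP : a `^ (1 + nu) = w `^ (1 + nu) * (u ^+ 2) `^ (1 + nu).
    by rewrite {1}aE powRM ?sqr_ge0.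
  have bP : b `^ (1 + nu) = w `^ (1 + nu) * (v ^+ 2) `^ (1 + nu).
    by rewrite {1}bE powRM ?sqr_ge0.
  rewrite /M aP bP [X in _ <= X](_ : _ = w `^ (1 + nu) *
    (p * (u ^+ 2) `^ (1 + nu) + (1 - p) * (v ^+ 2) `^ (1 + nu))); last by ring.
  rewrite ler_wpM2l ?powR_ge0 //.
  have hu := @sqr_powR_tangent u nu u0 (ltW nu0).
  have hv := @sqr_powR_tangent v nu v0 (ltW nu0).
  have q0 : 0 <= 1 - p by lra.
  have p0 : 0 <= p by lra.
  have := lerD (ler_wpM2l p0 hu) (ler_wpM2l q0 hv).
  apply: le_trans.
  have := ler_wpM2l (ltW nu0) gap.
  rewrite !sqrrB1; nra.
have g0 : 0 <= 1 - lam / 32 * nu * s.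
  have : lam * nu * s <= 1 by nra.
  lra.
apply: le_trans (ler_wpM2l g0 leW).
rewrite mulrCA ler_peMr ?powR_ge0 //.
have x0 : 0 <= lam * nu by nra.
have x1 : lam * nu <= 1 / 2 by nra.
have xs : (lam * nu) * s <= lam * nu by rewrite ler_piMr.
have xxs : (lam * nu) * ((lam * nu) * s) <= 1 / 2 * (lam * nu).
  by apply: ler_pM => //; rewrite mulr_ge0.
rewrite (_ : (1 - _) * _ = 1 + lam * nu / 8 - lam * nu * s / 32
  - lam * nu * (lam * nu * s) / 256); last by field.
lra.
Qed.

(** Hoelder's inequality with the conjugate exponents (1 + nu) / nu and 1 + nu,
    normalised so that no root has to be taken and no mean has to be nonzero. *)
Lemma hoelder_powR (I : finType) (w f g : I -> R) (nu : R) : 0 < nu ->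
  (forall i, 0 <= w i) -> (forall i, 0 <= f i) -> (forall i, 0 <= g i) ->
  \sum_i w i * f i `^ ((1 + nu) / nu) <= 1 ->
  (\sum_i w i * (f i * g i)) `^ (1 + nu) <= \sum_i w i * g i `^ (1 + nu).
Proof.
move=> nu0 w0 f0 g0 le1; set m := \sum_i _; set M := \sum_i _.
have r0 : 0 < 1 + nu by lra.
have t0 : 0 < (1 + nu) / nu by rewrite divr_gt0.
have m0 : 0 <= m by apply: sumr_ge0 => i _; rewrite !mulr_ge0.
have conj : ((1 + nu) / nu)^-1 + (1 + nu)^-1 = 1.
  by rewrite invf_div -[X in _ + X]mul1r -mulrDl addrC divff // gt_eqF.
have : \sum_i w i * (f i * g i) * m `^ nu <=
    \sum_i (w i * f i `^ ((1 + nu) / nu)) * (m `^ (1 + nu) / ((1 + nu) / nu)) +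
    \sum_i (w i * g i `^ (1 + nu)) / (1 + nu).
  rewrite -big_split; apply: ler_sum => i _ /=.
  have := @conjugate_powR R (f i * m `^ nu) (g i) _ _
    (mulr_ge0 (f0 i) (powR_ge0 _ _)) (g0 i) t0 r0 conj.
  rewrite powRM ?powR_ge0 // -powRrM (_ : nu * ((1 + nu) / nu) = 1 + nu).
    by move=> /(ler_wpM2l (w0 i)); congr (_ <= _); ring.
  by rewrite mulrC divfK // gt_eqF.
rewrite -!mulr_suml -/m -/M.
have -> : m * m `^ nu = m `^ (1 + nu).
  by rewrite -[RHS](mulr_powRB1 m0) // addrC addKr.
have le2 : (\sum_i w i * f i `^ ((1 + nu) / nu)) *
   (m `^ (1 + nu) / ((1 + nu) / nu)) <= m `^ (1 + nu) / ((1 + nu) / nu).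
  by rewrite ler_piMl // divr_ge0 ?powR_ge0 // ltW.
move=> /le_trans/(_ (lerD le2 (lexx _))).
have -> : ((1 + nu) / nu)^-1 = 1 - (1 + nu)^-1.
  by apply/eqP; rewrite eq_sym subr_eq conj.
move=> le3.
have : m `^ (1 + nu) / (1 + nu) <= M / (1 + nu) by lra.
by rewrite ler_pM2r // invr_gt0.
Qed.

End PowerInequalities.

(** * Interference of two complex numbers *)

Section Twist.
Variable R : realType.
Local Notation normc := (@ComplexField.Normc.normc R).

(** E b c is the factor contributed by one coordinate when the first vector has
    the side b and the second one the sign c. For a fixed b, only the phase of
    E b true relative to E b false matters; the condition says that the two
    relative phases, for b = true and b = false, are not nearly equal, so that
    the same two nonzero numbers cannot be aligned by both. *)
Definition dephasing (s : R) (E : bool -> bool -> R[i]) : Prop :=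
  (forall b c, normc (E b c) = 1) /\
  normc (E true true * (E true false)^*%C +
         E false true * (E false false)^*%C) <= 2 - s.

Lemma sqr_normc (z : R[i]) : normc z ^+ 2 = complex.Re z ^+ 2 + complex.Im z ^+ 2.
Proof. by case: z => a b /=; rewrite sqr_sqrtr // addr_ge0 ?sqr_ge0. Qed.

Lemma normc_ge0 (z : R[i]) : 0 <= normc z.
Proof. by case: z => a b /=; rewrite sqrtr_ge0. Qed.

Lemma normc_real (x : R) : 0 <= x -> normc x%:C%C = x.
Proof. by move=> x0 /=; rewrite expr0n addr0 sqrtr_sqr ger0_norm. Qed.

Lemma Re_le_normc (z : R[i]) : complex.Re z <= normc z.
Proof.
case: z => a b /=; apply: le_trans (ler_norm a) _.
by rewrite -sqrtr_sqr ler_wsqrtr // lerDl sqr_ge0.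
Qed.

Lemma sqr_normc_interference (p q : R) (z1 z0 e1 e0 : R[i]) :
  normc e1 = 1 -> normc e0 = 1 ->
  normc (p%:C%C * (z1 * e1) + q%:C%C * (z0 * e0)) ^+ 2 =
  p ^+ 2 * normc z1 ^+ 2 + q ^+ 2 * normc z0 ^+ 2 +
  2 * (p * q) * complex.Re (z1 * z0^*%C * (e1 * e0^*%C)).
Proof.
move=> /(congr1 (fun r => r ^+ 2)); rewrite sqr_normc expr1n => n1.
move=> /(congr1 (fun r => r ^+ 2)); rewrite sqr_normc expr1n => n0.
have -> : normc z1 ^+ 2 = normc z1 ^+ 2 *
    (complex.Re e1 ^+ 2 + complex.Im e1 ^+ 2)
  by rewrite n1 mulr1.
have -> : normc z0 ^+ 2 = normc z0 ^+ 2 *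
    (complex.Re e0 ^+ 2 + complex.Im e0 ^+ 2)
  by rewrite n0 mulr1.
rewrite !sqr_normc.
case: z1 => a1 b1; case: z0 => a0 b0.
case: e1 {n1} => c1 d1; case: e0 {n0} => c0 d0 /=.
by ring.
Qed.

(** The two interference terms, for b = true and b = false, add up to at most
    (2 - s) * normc z1 * normc z0, hence one of them is at most half of that. *)
Lemma dephasing_gain (lam nu s p q : R) E (z1 z0 : R[i]) :
  0 <= lam -> 0 < nu <= 1 -> 0 <= s <= 1 -> lam <= p -> lam <= q -> p + q = 1 ->
  dephasing s E ->
  exists b, normc (p%:C%C * (z1 * E b true) + q%:C%C * (z0 * E b false))
      `^ (1 + nu) <=
    (1 - lam / 32 * nu * s) *
    (p * normc z1 `^ (1 + nu) + q * normc z0 `^ (1 + nu)).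
Proof.
move=> lam0 nu01 s01 lamp lamq pq [E1 Es].
have -> : q = 1 - p by lra.
have [qE p0 q0] : [/\ q = 1 - p, 0 <= p & 0 <= 1 - p] by split; lra.
pose Q b := complex.Re (z1 * z0^*%C * (E b true * (E b false)^*%C)).
have QE : Q true + Q false <= normc z1 * normc z0 * (2 - s).
  rewrite /Q -raddfD -mulrDr; apply: le_trans (Re_le_normc _) _.
  rewrite !ComplexField.Normc.normcM.
  have -> : normc z0^*%C = normc z0 by case: z0 {Q} => a b /=; rewrite sqrrN.
  by rewrite ler_wpM2l // mulr_ge0 ?normc_ge0.
have [b Qb] : exists b, Q b <= normc z1 * normc z0 * (1 - s / 2).
  case: (lerP (Q true) (normc z1 * normc z0 * (1 - s / 2))) => h.
    by exists true.
  exists false; lra.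
exists b; apply: two_point_gain; rewrite ?normc_ge0 //; first by lra.
rewrite sqr_normc_interference // -/(Q b).
have : p * (1 - p) * Q b <= p * (1 - p) * (normc z1 * normc z0 * (1 - s / 2)).
  by rewrite ler_wpM2l // mulr_ge0.
lra.
Qed.

Lemma no_dephasing (nu p q : R) (E : bool -> bool -> R[i]) (z1 z0 : R[i]) b :
  0 < nu -> 0 <= p -> 0 <= q -> p + q = 1 ->
  (forall b c, normc (E b c) = 1) ->
  normc (p%:C%C * (z1 * E b true) + q%:C%C * (z0 * E b false)) `^ (1 + nu) <=
    p * normc z1 `^ (1 + nu) + q * normc z0 `^ (1 + nu).
Proof.
move=> nu0 p0 q0 pq E1.
have qE : q = 1 - p by lra.
rewrite qE in q0 *.
apply: le_trans (jensen_powR2 _ _ _ _); rewrite ?normc_ge0 //; [|lra|lra].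
rewrite ge0_ler_powR ?nnegrE ?normc_ge0 //; first by lra.
  by rewrite addr_ge0 // mulr_ge0 ?normc_ge0 //; lra.
apply: le_trans (complex.le_normcD _ _) _.
by rewrite !ComplexField.Normc.normcM !E1 !normc_real // !mulr1.
Qed.

End Twist.

(** * Free coordinates and entropy *)

Section Cube.
Variable R : realType.
Local Notation cube n := {ffun 'I_n -> bool}.

Definition fcons n (b : bool) (x : cube n) : cube n.+1 :=
  [ffun i => oapp x b (unlift ord0 i)].

Definition ftail n (x : cube n.+1) : cube n := [ffun i => x (lift ord0 i)].

Lemma fcons0 n b (x : cube n) : fcons b x ord0 = b.
Proof. by rewrite ffunE unlift_none. Qed.

Lemma fconsS n b (x : cube n) i : fcons b x (lift ord0 i) = x i.
Proof. by rewrite ffunE liftK. Qed.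

Lemma fconsK n b (x : cube n) : ftail (fcons b x) = x.
Proof. by apply/ffunP => i; rewrite ffunE fconsS. Qed.

Lemma fcons_ftail n (x : cube n.+1) : fcons (x ord0) (ftail x) = x.
Proof.
apply/ffunP => i; case: (unliftP ord0 i) => [j|] ->.
  by rewrite fconsS ffunE.
by rewrite fcons0.
Qed.

Lemma sum_fcons (V : nmodType) n (F : cube n.+1 -> V) :
  \sum_x F x = \sum_b \sum_x F (fcons b x).
Proof.
rewrite pair_big (reindex (fun bx : bool * cube n => fcons bx.1 bx.2)) //=.
exists (fun x : cube n.+1 => (x ord0, ftail x)) => [[b x] _|x _] /=.
  by rewrite fcons0 fconsK.
by rewrite fcons_ftail.
Qed.

Lemma sum_cube0 (V : nmodType) (F : cube 0 -> V) (x : cube 0) :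
  \sum_y F y = F x.
Proof.
rewrite (big_pred1 x) // => y; apply/esym/eqP/ffunP; by case.
Qed.

Definition balanced (lam P Q : R) : bool :=
  (lam * (P + Q) <= P) && (lam * (P + Q) <= Q).

(** For y drawn with weights p: the coordinates i such that the bit y i is not
    nearly determined by the bits of smaller index. *)
Fixpoint free_given_past (lam : R) n : (cube n -> R) -> cube n -> 'I_n -> bool :=
  match n with
  | 0 => fun _ _ _ => false
  | m.+1 => fun p y i =>
      if unlift ord0 i is Some j then
        free_given_past lam (fun y' => p (fcons (y ord0) y')) (ftail y) j
      else balanced lam (\sum_y' p (fcons true y')) (\sum_y' p (fcons false y'))
  end.

(** For x drawn with weights q: the coordinates i such that the bit x i is not
    nearly determined by the bits of larger index. The order is
    opposite to that of free_given_past because the two complex numbers combined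
    at coordinate i, which are means over the bits of y of larger index, depend
    only on the bits of x of larger index: given those, x i is still random. *)
Fixpoint free_given_future (lam : R) n : (cube n -> R) -> cube n -> 'I_n -> bool :=
  match n with
  | 0 => fun _ _ _ => false
  | m.+1 => fun q x i =>
      if unlift ord0 i is Some j then
        free_given_future lam (fun x' => q (fcons true x') + q (fcons false x'))
          (ftail x) j
      else balanced lam (q (fcons true (ftail x))) (q (fcons false (ftail x)))
  end.

(** If the bit is balanced, Cauchy-Schwarz costs Num.sqrt 2, which is paid for
    by the first factor; otherwise one of the two roots is negligible. *)
Lemma balanced_sqrt lam P Q : 0 <= lam -> 0 <= P -> 0 <= Q ->
  (Num.sqrt 2)^-1 ^+ balanced lam P Q * (Num.sqrt P + Num.sqrt Q) <=
    (1 + Num.sqrt lam) * Num.sqrt (P + Q).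
Proof.
move=> lam0 P0 Q0.
have T0 : 0 <= P + Q by rewrite addr_ge0.
have S0 := sqrtr_ge0 (P + Q).
have l0 := sqrtr_ge0 lam.
have PT : Num.sqrt P <= Num.sqrt (P + Q) by rewrite ler_wsqrtr // lerDl.
have QT : Num.sqrt Q <= Num.sqrt (P + Q) by rewrite ler_wsqrtr // lerDr.
have small X : X < lam * (P + Q) -> Num.sqrt X <= Num.sqrt lam * Num.sqrt (P + Q).
  by move=> /ltW h; rewrite -sqrtrM // ler_wsqrtr.
rewrite /balanced; case: (lerP _ P) => [_|/small h] /=; last first.
  by rewrite expr0 mul1r mulrDl mul1r addrC; apply: lerD.
case: (lerP _ Q) => [_|/small h] /=; last first.
  by rewrite expr0 mul1r mulrDl mul1r; apply: lerD.
rewrite expr1; apply: (@le_trans _ _ (Num.sqrt (P + Q))); last first.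
  by rewrite ler_peMl // lerDl.
rewrite mulrC ler_pdivrMr ?sqrtr_gt0 // -sqrtrM //.
rewrite -(@ler_pXn2r _ 2) ?nnegrE ?sqrtr_ge0 ?addr_ge0 ?sqrtr_ge0 //.
rewrite sqr_sqrtr ?mulr_ge0 // sqrrD !sqr_sqrtr //.
have := sqr_ge0 (Num.sqrt P - Num.sqrt Q).
rewrite sqrrB !sqr_sqrtr //; lra.
Qed.

(** For p uniform on a set of 2 `^ h points this says that the number of free
    coordinates is rarely much smaller than h, a form of the chain rule for
    entropy. *)
Lemma entropy_past lam n (p : cube n -> R) : 0 <= lam -> (forall y, 0 <= p y) ->
  \sum_y Num.sqrt (p y) *
    (Num.sqrt 2)^-1 ^+ (\sum_i free_given_past lam p y i) <=
  (1 + Num.sqrt lam) ^+ n * Num.sqrt (\sum_y p y).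
Proof.
move=> lam0; elim: n p => [|n IH] p p0.
  rewrite !(@sum_cube0 _ _ [ffun=> false]) big_ord0 !expr0.
  by rewrite mulr1 mul1r.
rewrite !sum_fcons !big_bool /=.
set P := fun b => \sum_y p (fcons b y).
have sumE b : \sum_(y : cube n) Num.sqrt (p (fcons b y)) *
    (Num.sqrt 2)^-1 ^+ (\sum_i free_given_past lam p (fcons b y) i) =
  (Num.sqrt 2)^-1 ^+ balanced lam (P true) (P false) *
    \sum_y Num.sqrt (p (fcons b y)) * (Num.sqrt 2)^-1 ^+
      (\sum_i free_given_past lam (fun y => p (fcons b y)) y i).
  rewrite mulr_sumr; apply: eq_bigr => y _; rewrite big_ord_recl /= unlift_none.
  rewrite exprD mulrCA; congr (_ * (_ * _ ^+ _)).
  by apply: eq_bigr => i _; rewrite liftK fcons0 fconsK.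
rewrite !sumE -mulrDr.
have IHb b := IH (fun y => p (fcons b y)) (fun y => p0 _).
have c0 : 0 <= (Num.sqrt 2)^-1 ^+ balanced lam (P true) (P false) :> R.
  by rewrite exprn_ge0 // invr_ge0 sqrtr_ge0.
apply: le_trans (ler_wpM2l c0 (lerD (IHb true) (IHb false))) _.
rewrite -mulrDr mulrCA exprSr -mulrA ler_wpM2l ?exprn_ge0 ?addr_ge0 ?sqrtr_ge0 //.
by rewrite balanced_sqrt //; apply: sumr_ge0.
Qed.

Lemma entropy_future lam n (q : cube n -> R) : 0 <= lam -> (forall x, 0 <= q x) ->
  \sum_x Num.sqrt (q x) *
    (Num.sqrt 2)^-1 ^+ (\sum_i free_given_future lam q x i) <=
  (1 + Num.sqrt lam) ^+ n * Num.sqrt (\sum_x q x).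
Proof.
move=> lam0; elim: n q => [|n IH] q q0.
  rewrite !(@sum_cube0 _ _ [ffun=> false]) big_ord0 !expr0.
  by rewrite mulr1 mul1r.
rewrite !sum_fcons ![\sum_(b : bool) _]big_bool /= -!big_split /=.
set q' := fun x => q (fcons true x) + q (fcons false x).
have q'0 x : 0 <= q' x by rewrite addr_ge0.
rewrite exprS -mulrA.
have c0 : 0 <= 1 + Num.sqrt lam by rewrite addr_ge0 // sqrtr_ge0.
apply: le_trans (ler_wpM2l c0 (IH q' q'0)).
rewrite mulr_sumr; apply: ler_sum => x _.
have expE b : (Num.sqrt 2)^-1 ^+ (\sum_i free_given_future lam q (fcons b x) i)
  = (Num.sqrt 2)^-1 ^+ balanced lam (q (fcons true x)) (q (fcons false x)) *
    (Num.sqrt 2)^-1 ^+ (\sum_i free_given_future lam q' x i) :> R.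
  rewrite big_ord_recl /= unlift_none fconsK exprD; congr (_ * _ ^+ _).
  by apply: eq_bigr => i _; rewrite liftK.
rewrite !expE -mulrDl mulrA [in X in _ <= X]mulrA
  ler_wpM2r ?exprn_ge0 ?invr_ge0 ?sqrtr_ge0 //.
by rewrite mulrC balanced_sqrt.
Qed.

End Cube.

(** * Twisted means over the cube *)

Section TwistedMean.
Variable R : realType.
Local Notation cube n := {ffun 'I_n -> bool}.
Local Notation normc := (@ComplexField.Normc.normc R).

Definition twisted_sum n (K : 'I_n -> bool -> bool -> R[i]) (p : cube n -> R)
    (x : cube n) : R[i] :=
  \sum_y (p y)%:C%C * \prod_i K i (x i) (y i).

Lemma twisted_sum_fcons n (K : 'I_n.+1 -> bool -> bool -> R[i]) p b (x : cube n) :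
  twisted_sum K p (fcons b x) =
  \sum_c K ord0 b c *
    twisted_sum (fun i => K (lift ord0 i)) (fun y => p (fcons c y)) x.
Proof.
rewrite /twisted_sum sum_fcons; apply: eq_bigr => c _; rewrite mulr_sumr.
apply: eq_bigr => y _; rewrite big_ord_recl !fcons0 mulrCA; congr (_ * (_ * _)).
by apply: eq_bigr => i _; rewrite !fconsS.
Qed.

(** One of the two values of the bit, of probability at least lam, gains a factor
    1 - lam / 32 * nu * s; after raising to the power (1 + nu) / nu the gain no
    longer depends on nu. *)
Lemma balanced_contraction (lam nu s : R) (Q rho : bool -> R) :
  0 <= lam <= 1 -> 0 < nu <= 1 ->
  0 <= s <= 1 -> (forall b, 0 <= Q b) -> (forall b, 0 <= rho b <= 1) ->
  balanced lam (Q true) (Q false) ->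
  (exists b, rho b <= 1 - lam / 32 * nu * s) ->
  \sum_b Q b * (rho b `^ ((1 + nu) / nu) * expR (lam ^+ 2 / 64 * s)) <=
    Q true + Q false.
Proof.
move=> /andP[l0 l1] /andP[nu0 nu1] /andP[s0 s1] Q0 rho01 /andP[lQ1 lQ0] [b rb].
set t := (1 + nu) / nu; set e := expR _.
have t0 : 0 < t by rewrite divr_gt0 // addr_gt0.
pose T := Q true + Q false.
have TE : T = Q b + Q (~~ b) by rewrite /T; case: (b) => //=; rewrite addrC.
have T0 : 0 <= T by rewrite addr_ge0.
have lQb : lam * T <= Q b by case: (b).
rewrite big_bool /= -/T.
suff : Q b * rho b `^ t + Q (~~ b) * rho (~~ b) `^ t <= T * e^-1.
  rewrite ler_pdivlMr ?expR_gt0 // mulrDl -!mulrA.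
  by case: (b) => //=; rewrite addrC.
have rbad : rho (~~ b) `^ t <= 1.
  by rewrite powR_le1 // ltW.
have ls : 0 <= lam / 32 * s <= 1 by apply/andP; split; nra.
have rgood : rho b `^ t <= 1 - lam / 64 * s.
  apply: (@le_trans _ _ (expR (- (lam / 32 * nu * s)) `^ t)).
    have /andP[r0 r1] := rho01 b.
    rewrite ge0_ler_powR ?nnegrE ?expR_ge0 ?(ltW t0) //.
    apply: le_trans rb _; apply: le_trans (expR_ge1Dx _); lra.
  rewrite -expRM (_ : _ * t = - ((lam / 32 * s) * (1 + nu))); last first.
    by rewrite /t; field; rewrite gt_eqF.
  apply: (@le_trans _ _ (expR (- (lam / 32 * s)))).
    by rewrite ler_expR; nra.
  rewrite expRN -div1r ler_pdivrMr ?expR_gt0 //.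
  have := expR_ge1Dx (lam / 32 * s).
  set u := lam / 32 * s in ls *; have -> : lam / 64 * s = u / 2 by rewrite /u; field.
  move=> h; have h2 : 0 <= 1 - u / 2 by lra.
  have := ler_wpM2l h2 h; nra.
have einv : 1 - lam ^+ 2 / 64 * s <= e^-1.
  rewrite /e -expRN; exact: expR_ge1Dx.
apply: le_trans (ler_wpM2l T0 einv).
apply: (@le_trans _ _ (Q b * (1 - lam / 64 * s) + Q (~~ b) * 1)).
  by apply: lerD; apply: ler_wpM2l.
have : lam * T * (lam / 64 * s) <= Q b * (lam / 64 * s).
  by rewrite ler_wpM2r //; lra.
rewrite TE; lra.
Qed.

(** By induction on the number of coordinates. W x y is a product over the
    coordinates of factors 1 - lam / 32 * nu * s i or 1, according to whether
    coordinate i of x realises the gain of dephasing_gain. Given the later bits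
    of x, at least one value of the current bit does if the bit of y is free, so
    that the expected ((1 + nu) / nu)-th power of the factor decreases whenever
    the current bits of x and of y are both free. Compensating for this decrease
    by the exponential factor yields a supermartingale in x, revealed from its
    last bit, for each y: this is the last bound. The second one iterates the
    gain, or plain convexity, over the coordinates. *)
Lemma twisted_mean_bound n (K : 'I_n -> bool -> bool -> R[i]) (s : 'I_n -> R)
    (p q : cube n -> R) (lam nu : R) :
  0 <= lam <= 1 -> 0 < nu <= 1 -> (forall i, 0 <= s i <= 1) ->
  (forall i, dephasing (s i) (K i)) ->
  (forall y, 0 <= p y) -> (forall x, 0 <= q x) ->
  exists W : cube n -> cube n -> R,
  [/\ forall x y, 0 <= W x y,
      forall x, (normc (twisted_sum K p x) / \sum_y p y) `^ (1 + nu) <=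
        (\sum_y p y * W x y) / \sum_y p y
    & forall y, \sum_x q x * (W x y `^ ((1 + nu) / nu) *
        expR (lam ^+ 2 / 64 * \sum_i s i *
          (free_given_past lam p y i && free_given_future lam q x i)%:R)) <=
        \sum_x q x].
Proof.
move=> lam01 nu01; have /andP[nu0 nu1] := nu01.
have r0 : 0 < 1 + nu by rewrite addr_gt0.
elim: n K s p q => [|n IH] K s p q s01 Ks p0 q0.
  exists (fun _ _ => 1); split=> //.
    move=> x; rewrite /twisted_sum !(sum_cube0 _ x) big_ord0 mulr1.
    rewrite normc_real // mulr1; have [->|px0] := eqVneq (p x) 0.
      by rewrite mul0r powR0 // gt_eqF.
    by rewrite divff // powR1.
  move=> y; rewrite !(sum_cube0 _ y) big_ord0 mulr0 expR0 powR1.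
  by rewrite !mulr1.
pose q' x := q (fcons true x) + q (fcons false x).
pose pc c (y : cube n) := p (fcons c y).
pose K' (i : 'I_n) := K (lift ord0 i).
have {IH}/choice[W HW] : forall c, exists W : cube n -> cube n -> R,
  [/\ forall x y, 0 <= W x y,
      forall x, (normc (twisted_sum K' (pc c) x) / \sum_y pc c y) `^ (1 + nu) <=
        (\sum_y pc c y * W x y) / \sum_y pc c y
    & forall y, \sum_x q' x * (W x y `^ ((1 + nu) / nu) *
        expR (lam ^+ 2 / 64 * \sum_i s (lift ord0 i) *
          (free_given_past lam (pc c) y i && free_given_future lam q' x i)%:R)) <=
        \sum_x q' x].
  move=> c; apply: IH => [i|i|y|x]; [exact: s01|exact: Ks|exact: p0|].
  by rewrite addr_ge0.
pose P c := \sum_y pc c y.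
have P0 c : 0 <= P c by apply: sumr_ge0 => y _; exact: p0.
have PE : \sum_y p y = P true + P false by rewrite sum_fcons big_bool.
pose F c := twisted_sum K' (pc c).
pose A x := \sum_c P c / (P true + P false) * (normc (F c x) / P c) `^ (1 + nu).
have A0 x : 0 <= A x.
  by apply: sumr_ge0 => c _; rewrite mulr_ge0 ?powR_ge0 // divr_ge0 ?addr_ge0.
pose H x := (normc (twisted_sum K p x) / (P true + P false)) `^ (1 + nu).
pose g := 1 - lam / 32 * nu * s ord0.
have g01 : 0 <= g <= 1.
  have /andP[s0 s1] := s01 ord0; have /andP[l0 l1] := lam01.
  have := mulr_ge0 (mulr_ge0 l0 (ltW nu0)) s0.
  have : lam * nu * s ord0 <= 1 by rewrite mulr_ile1 ?mulr_ge0 ?mulr_ile1 // ltW.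
  rewrite /g; lra.
(* The factor of the first coordinate; it depends on x but not on y. *)
pose rho x := if H x <= g * A (ftail x) then g else 1.
have rho01 x : 0 <= rho x <= 1 by rewrite /rho; case: ifP; rewrite // ler01 lexx.
pose z c x := (P c)^-1%:C%C * F c x.
have FE c x : F c x = (P c)%:C%C * z c x.
  have [Pc0|Pc0] := eqVneq (P c) 0.
    rewrite /F /twisted_sum Pc0 mul0r big1 // => y _.
    suff -> : pc c y = 0 by rewrite mul0r.
    by apply: (psumr_eq0P _ Pc0) => // y' _; exact: p0.
  by rewrite /z mulrA -rmorphM /= divff // mul1r.
have nz c x : normc (z c x) = normc (F c x) / P c.
  by rewrite ComplexField.Normc.normcM normc_real ?invr_ge0 // mulrC.
have HE b x : P true + P false != 0 -> H (fcons b x) =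
    normc ((P true / (P true + P false))%:C%C * (z true x * K ord0 b true) +
           (P false / (P true + P false))%:C%C * (z false x * K ord0 b false))
      `^ (1 + nu).
  move=> PT; rewrite /H; congr (_ `^ _).
  have T0 : 0 <= (P true + P false)^-1 by rewrite invr_ge0 addr_ge0.
  transitivity (normc (twisted_sum K p (fcons b x) *
      ((P true + P false)^-1)%:C%C)).
    by rewrite ComplexField.Normc.normcM normc_real.
  congr (normc _).
  rewrite twisted_sum_fcons big_bool /= -/(F true x) -/(F false x) !FE !rmorphM /=.
  by ring.
have AE x : A x = P true / (P true + P false) * normc (z true x) `^ (1 + nu) +
                  P false / (P true + P false) * normc (z false x) `^ (1 + nu).
  by rewrite /A big_bool !nz.
have w1 : P true + P false != 0 ->
    P true / (P true + P false) + P false / (P true + P false) = 1.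
  by move=> PT; rewrite -mulrDl divff.
have w0 c : 0 <= P c / (P true + P false) by rewrite divr_ge0 ?addr_ge0.
have Hrho x : H x <= rho x * A (ftail x).
  rewrite /rho; case: ifP => // _; rewrite mul1r -[x in H x]fcons_ftail.
  have [PT|PT] := eqVneq (P true + P false) 0.
    by rewrite /H PT invr0 mulr0 powR0 // gt_eqF.
  rewrite HE // AE; apply: no_dephasing => //; first exact: w1.
  by case: (Ks ord0).
have good x : balanced lam (P true) (P false) ->
    exists b, rho (fcons b x) <= g.
  move=> /andP[lP1 lP0].
  suff [b Hb] : exists b, H (fcons b x) <= g * A x.
    by exists b; rewrite /rho fconsK Hb.
  have [PT|PT] := eqVneq (P true + P false) 0.
    exists true; rewrite /H PT invr0 mulr0 powR0 ?mulr_ge0 ?gt_eqF //.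
    by case/andP: g01.
  have PT0 : 0 < P true + P false by rewrite lt_neqAle eq_sym PT addr_ge0.
  have /andP[l0 _] := lam01.
  have [||b Hb] := dephasing_gain (z true x) (z false x) l0 nu01 (s01 ord0) _ _
    (w1 PT) (Ks ord0); rewrite ?ler_pdivlMr //.
  by exists b; rewrite HE // AE.
exists (fun x (y : cube n.+1) => rho x * W (y ord0) (ftail x) (ftail y)); split.
- move=> x y; have [W0 _ _] := HW (y ord0).
  by rewrite mulr_ge0 //; case/andP: (rho01 x).
- move=> x; rewrite PE -/(H x); apply: le_trans (Hrho x) _.
  have -> : \sum_(y : cube n.+1) p y * (rho x * W (y ord0) (ftail x) (ftail y)) =
    rho x * \sum_c \sum_y pc c y * W c (ftail x) y.
    rewrite sum_fcons mulr_sumr; apply: eq_bigr => c _; rewrite mulr_sumr.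
    by apply: eq_bigr => y _; rewrite fcons0 fconsK mulrCA.
  rewrite -mulrA ler_wpM2l //; first by case/andP: (rho01 x).
  rewrite mulr_suml; apply: ler_sum => c _; rewrite mulrAC.
  rewrite ler_wpM2r ?invr_ge0 ?addr_ge0 //.
  have [W0 Wm _] := HW c; have {Wm} := ler_wpM2l (P0 c) (Wm (ftail x)).
  move=> /le_trans; apply; have [Pc0|Pc0] := eqVneq (P c) 0.
    by rewrite Pc0 mul0r; apply: sumr_ge0 => y _; rewrite mulr_ge0 //; exact: p0.
  by rewrite mulrC divfK.
move=> y; rewrite !sum_fcons ![\sum_(b : bool) _]big_bool /= -!big_split /=.
have [W0 _ Wt] := HW (y ord0); apply: le_trans (Wt (ftail y)).
apply: ler_sum => x _.
set w := W _ x _; set E := (X in _ <= _ * (_ * X)).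
set m := balanced lam (P true) (P false) &&
         balanced lam (q (fcons true x)) (q (fcons false x)).
have xE b : q (fcons b x) * ((rho (fcons b x) *
    W (y ord0) (ftail (fcons b x)) (ftail y)) `^ ((1 + nu) / nu) *
    expR (lam ^+ 2 / 64 * \sum_i s i *
      (free_given_past lam p y i && free_given_future lam q (fcons b x) i)%:R)) =
  q (fcons b x) * (rho (fcons b x) `^ ((1 + nu) / nu) *
    expR (lam ^+ 2 / 64 * (s ord0 * m%:R))) * (w `^ ((1 + nu) / nu) * E).
  rewrite fconsK powRM ?W0 //; last by case/andP: (rho01 (fcons b x)).
  rewrite -/w.
  have m0 : free_given_past lam p y ord0 &&
      free_given_future lam q (fcons b x) ord0 = m.
    by rewrite /= unlift_none fconsK.
  rewrite big_ord_recl m0 mulrDr expRD.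
  have -> : expR (lam ^+ 2 / 64 * \sum_(i < n) s (lift ord0 i) *
     (free_given_past lam p y (lift ord0 i) &&
      free_given_future lam q (fcons b x) (lift ord0 i))%:R) = E.
    congr (expR (_ * _)); apply: eq_bigr => i _.
    by rewrite /= liftK fconsK.
  by ring.
rewrite !xE -mulrDl ler_wpM2r ?mulr_ge0 ?powR_ge0 ?expR_ge0 //.
have t0 : 0 <= (1 + nu) / nu by rewrite divr_ge0 // ltW.
have unbalanced b : q (fcons b x) * (rho (fcons b x) `^ ((1 + nu) / nu) *
    expR (lam ^+ 2 / 64 * (s ord0 * 0))) <= q (fcons b x).
  by rewrite !mulr0 expR0 mulr1 ler_piMr // powR_le1.
case mE : m; last first.
  by rewrite /= mulr0n; apply: lerD; exact: unbalanced.
have /andP[bP bQ] : m by rewrite mE.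
rewrite /= mulr1n mulr1.
have := @balanced_contraction lam nu (s ord0) (fun b => q (fcons b x))
  (fun b => rho (fcons b x)) lam01 nu01 (s01 _) (fun b => q0 _)
  (fun b => rho01 _) bQ (good x bP).
by rewrite big_bool.
Qed.

End TwistedMean.

(** * The bound for two independent sources *)

Section TwoSource.
Variable R : realType.
Local Notation cube n := {ffun 'I_n -> bool}.
Local Notation normc := (@ComplexField.Normc.normc R).

(** One factor 1 + nu of the exponent is spent on the convexity inequality of
    twisted_mean_bound, the other one on Hoelder's inequality, which trades the
    random product W for the compensator. *)
Lemma two_source_bound n (K : 'I_n -> bool -> bool -> R[i]) (s : 'I_n -> R)
    (p q : cube n -> R) (lam nu : R) :
  0 <= lam <= 1 -> 0 < nu <= 1 -> (forall i, 0 <= s i <= 1) ->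
  (forall i, dephasing (s i) (K i)) ->
  (forall y, 0 <= p y) -> (forall x, 0 <= q x) ->
  \sum_y p y = 1 -> \sum_x q x = 1 ->
  (\sum_x q x * normc (twisted_sum K p x)) `^ ((1 + nu) ^+ 2) <=
  \sum_x \sum_y q x * p y * expR (- (lam ^+ 2 / 64 * nu * \sum_i s i *
    (free_given_past lam p y i && free_given_future lam q x i)%:R)).
Proof.
move=> lam01 nu01 s01 Ks p0 q0 p1 q1; have /andP[nu0 nu1] := nu01.
have r0 : 0 < 1 + nu by rewrite addr_gt0.
have [W [W0 Wm Wt]] := twisted_mean_bound lam01 nu01 s01 Ks p0 q0.
rewrite expr2 powRrM.
pose B x y := \sum_i s i *
  (free_given_past lam p y i && free_given_future lam q x i)%:R.
have meanW : (\sum_x q x * normc (twisted_sum K p x)) `^ (1 + nu) <=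
    \sum_x \sum_y q x * p y * W x y.
  apply: le_trans (jensen_powR _ q0 q1 _) _; [by rewrite lerDl ltW| |].
    by move=> x; exact: normc_ge0.
  apply: ler_sum => x _; under eq_bigr do rewrite -mulrA.
  rewrite -mulr_sumr ler_wpM2l //.
  by have := Wm x; rewrite p1 invr1 !mulr1.
apply: (@le_trans _ _ ((\sum_x \sum_y q x * p y * W x y) `^ (1 + nu))).
  rewrite ge0_ler_powR ?nnegrE ?powR_ge0 ?(ltW r0) //.
  by apply: sumr_ge0 => x _; apply: sumr_ge0 => y _; rewrite !mulr_ge0.
set e := lam ^+ 2 / 64.
pose h x y := expR (e * nu / (1 + nu) * B x y).
have hV x y : h x y * (h x y)^-1 = 1 by rewrite divff // gt_eqF ?expR_gt0.
rewrite [leLHS](_ : _ = (\sum_xy (q xy.1 * p xy.2) *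
    (W xy.1 xy.2 * h xy.1 xy.2 * (h xy.1 xy.2)^-1)) `^ (1 + nu)); last first.
  rewrite pair_big /=; congr (_ `^ _); apply: eq_bigr => -[x y] _ /=.
  by rewrite -(mulrA (W x y)) hV mulr1.
rewrite [leRHS](_ : _ = \sum_xy (q xy.1 * p xy.2) *
    (h xy.1 xy.2)^-1 `^ (1 + nu)); last first.
  rewrite pair_big /=; apply: eq_bigr => -[x y] _ /=; congr (_ * _).
  rewrite -expRN -expRM; congr expR.
  by rewrite -/(B x y) -/e; field; rewrite gt_eqF.
apply: hoelder_powR => // [xy|xy|xy|]; rewrite ?mulr_ge0 ?invr_ge0 ?expR_ge0 //.
rewrite -(pair_big predT predT (fun x y => q x * p y *
   (W x y * h x y) `^ ((1 + nu) / nu))) /= exchange_big /=.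
apply: (@le_trans _ _ (\sum_y p y * 1)); last by rewrite -mulr_suml p1 mulr1.
apply: ler_sum => y _; under eq_bigr do rewrite (mulrC (q _)) -mulrA.
rewrite -mulr_sumr ler_wpM2l //; have := Wt y; rewrite q1; apply: le_trans.
apply: ler_sum => x _; rewrite ler_wpM2l // powRM ?expR_ge0 // -expRM.
rewrite ler_wpM2l ?powR_ge0 // -/(B x y) -/e ler_expR.
by rewrite [leLHS](_ : _ = e * B x y) //; field; rewrite !gt_eqF.
Qed.

End TwoSource.

(** * Means over the circle *)

Section CircleMean.
Variable R : realType.
Local Notation mu := (@lebesgue_measure R).
Implicit Types f g : R -> R.

(** The circle is the interval from 0 to 1 with its endpoints identified: the
    functions of interest have period 1. *)
Definition circle_mean f : R := \int[mu]_(x in `[0, 1]%classic) f x.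

Lemma continuous_integrable_segment f a b : continuous f ->
  mu.-integrable `[a, b]%classic (EFin \o f).
Proof.
move=> cf; apply: continuous_compact_integrable; first exact: segment_compact.
exact: continuous_subspaceT.
Qed.

Lemma circle_mean_le f g : continuous f -> continuous g ->
  (forall x, 0 <= x <= 1 -> f x <= g x) -> circle_mean f <= circle_mean g.
Proof.
move=> cf cg fg; apply: le_Rintegral => //; try exact: continuous_integrable_segment.
Qed.

Lemma circle_meanD f g : continuous f -> continuous g ->
  circle_mean (fun x => f x + g x) = circle_mean f + circle_mean g.
Proof.
by move=> cf cg; apply: RintegralD => //; exact: continuous_integrable_segment.
Qed.

Lemma circle_meanZ c f : continuous f ->
  circle_mean (fun x => c * f x) = c * circle_mean f.
Proof.
by move=> cf; apply: RintegralZl => //; exact: continuous_integrable_segment.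
Qed.

Lemma circle_mean_cst c : circle_mean (fun=> c) = c.
Proof.
rewrite /circle_mean Rintegral_cst //= lebesgue_measure_itv /= lte_fin ltr01.
by rewrite oppr0 adde0 mulr1.
Qed.

Lemma circle_mean_ge0 f : (forall x, 0 <= f x) -> 0 <= circle_mean f.
Proof. by move=> f0; apply: Rintegral_ge0. Qed.

Lemma continuous_scale c f : continuous f -> continuous (fun x => c * f x).
Proof. by move=> cf x; apply: continuousM; [exact: cst_continuous|exact: cf]. Qed.

Lemma continuous_shiftl c f : continuous f -> continuous (fun x => c + f x).
Proof. by move=> cf x; apply: continuousD; [exact: cst_continuous|exact: cf]. Qed.

Lemma circle_mean_sum (I : Type) (r : seq I) (F : I -> R -> R) :
  (forall i, continuous (F i)) ->
  continuous (fun x => \sum_(i <- r) F i x) /\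
  circle_mean (fun x => \sum_(i <- r) F i x) = \sum_(i <- r) circle_mean (F i).
Proof.
move=> cF; elim: r => [|i r [IHc IH]].
  have -> : (fun x => \sum_(i <- [::]) F i x) = fun=> 0.
    by apply/funext => x; rewrite big_nil.
  by rewrite big_nil circle_mean_cst; split=> // x; exact: cst_continuous.
have -> : (fun x => \sum_(j <- i :: r) F j x) =
    (fun x => F i x + \sum_(j <- r) F j x).
  by apply/funext => x; rewrite big_cons.
split; last by rewrite circle_meanD // big_cons IH.
by move=> x; apply: continuousD; [exact: cF|exact: IHc].
Qed.

Lemma Rintegral_shift f (c a b : R) : continuous f -> a <= b ->
  \int[mu]_(x in `[a + c, b + c]%classic) f x =
  \int[mu]_(x in `[a, b]%classic) f (x + c).
Proof.
move=> cf ab; rewrite /Rintegral; congr fine.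
have dS : derive1 (fun x : R => x + c) = cst 1.
  apply/funext => x; rewrite derive1E deriveD // derive_cst addr0.
  by rewrite -derive1E derive1_id.
have := @integration_by_substitution_increasing R (fun t => t + c) f a b ab.
move=> ->; first by apply: eq_integral => x _ /=; rewrite dS /= mulr1.
- by move=> x y _ _ xy; rewrite ltrD2r.
- by rewrite dS => x _; exact: cst_continuous.
- by rewrite dS; exact: is_cvg_cst.
- by rewrite dS; exact: is_cvg_cst.
- split=> //.
  + by apply: cvg_at_right_filter; apply: cvgD; [exact: cvg_id|exact: cvg_cst].
  + by apply: cvg_at_left_filter; apply: cvgD; [exact: cvg_id|exact: cvg_cst].
- exact: continuous_subspaceT.
Qed.

Lemma circle_mean_shift f (c : R) : continuous f -> (forall x, f (x + 1) = f x) ->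
  0 <= c <= 1 -> circle_mean (fun x => f (x + c)) = circle_mean f.
Proof.
move=> cf f1 /andP[c0 c1].
have split x y : 0 <= x -> x <= y -> \int[mu]_(t in `[0, y]%classic) f t =
    \int[mu]_(t in `[0, x]%classic) f t + \int[mu]_(t in `[x, y]%classic) f t.
  move=> x0 xy; have := @Rintegral_itvB R f (BLeft 0) (BRight y) x
    (continuous_integrable_segment 0 y cf).
  rewrite !bnd_simp => /(_ x0 xy).
  rewrite Rintegral_itv_obnd_cbnd; first by move=> <-; rewrite addrC subrK.
  apply: integrableS (continuous_integrable_segment 0 y cf) => //.
  by apply: subset_itvr; rewrite bnd_simp.
rewrite /circle_mean -(@Rintegral_shift f c 0 1) // add0r.
have := split c (1 + c) c0 _; rewrite lerDr => /(_ ler01) E1.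
have := split 1 (1 + c) ler01 _; rewrite lerDl => /(_ c0); rewrite E1.
have := @Rintegral_shift f 1 0 c cf c0; rewrite add0r (addrC c 1) => ->.
under [X in _ = _ + X]eq_Rintegral do rewrite f1.
by move/eqP; rewrite addrC (inj_eq (addIr _)) => /eqP.
Qed.

End CircleMean.

(** * Minkowski's inequality and a Gaussian sum *)

Section Minkowski.
Variable R : realType.

Lemma cauchy_schwarz_sum (I : finType) (P : pred I) (a b : I -> R) :
  (\sum_(i | P i) a i * b i) ^+ 2 <=
  (\sum_(i | P i) a i ^+ 2) * (\sum_(i | P i) b i ^+ 2).
Proof.
set A := \sum_(i | P i) a i ^+ 2; set B := \sum_(i | P i) b i ^+ 2.
set C := \sum_(i | P i) _.
have B0 : 0 <= B by apply: sumr_ge0 => i _; exact: sqr_ge0.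
have [B_eq0|Bn0] := eqVneq B 0.
  suff -> : C = 0 by rewrite B_eq0 mulr0 expr0n.
  rewrite /C big1 // => i Pi.
  have /eqP := psumr_eq0P (fun j (_ : P j) => sqr_ge0 (b j)) B_eq0 Pi.
  by rewrite sqrf_eq0 => /eqP ->; rewrite mulr0.
have : 0 <= \sum_(i | P i) (B * a i - C * b i) ^+ 2.
  by apply: sumr_ge0 => i _; exact: sqr_ge0.
have -> : \sum_(i | P i) (B * a i - C * b i) ^+ 2 = B * (A * B - C ^+ 2).
  rewrite (eq_bigr (fun i => B ^+ 2 * a i ^+ 2 - 2 * B * C * (a i * b i)
    + C ^+ 2 * b i ^+ 2)); last by move=> i _; ring.
  by rewrite big_split /= sumrB -!mulr_sumr -/A -/B -/C; ring.
by rewrite pmulr_rge0 ?subr_ge0 // lt_neqAle eq_sym Bn0.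
Qed.

Lemma minkowski_sum (I : finType) (P : pred I) (a b : I -> R) :
  Num.sqrt (\sum_(i | P i) (a i + b i) ^+ 2) <=
  Num.sqrt (\sum_(i | P i) a i ^+ 2) + Num.sqrt (\sum_(i | P i) b i ^+ 2).
Proof.
have A0 : 0 <= \sum_(i | P i) a i ^+ 2 by apply: sumr_ge0 => i _; exact: sqr_ge0.
have B0 : 0 <= \sum_(i | P i) b i ^+ 2 by apply: sumr_ge0 => i _; exact: sqr_ge0.
have AB0 : 0 <= \sum_(i | P i) (a i + b i) ^+ 2.
  by apply: sumr_ge0 => i _; exact: sqr_ge0.
rewrite -(@ler_pXn2r _ 2) ?nnegrE ?addr_ge0 ?sqrtr_ge0 //.
rewrite sqrrD !sqr_sqrtr // -sqrtrM //.
have := cauchy_schwarz_sum P a b => /ler_wsqrtr; rewrite sqrtr_sqr.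
move=> /(le_trans (ler_norm _)).
have -> : \sum_(i | P i) (a i + b i) ^+ 2 = \sum_(i | P i) a i ^+ 2 +
    2 * (\sum_(i | P i) a i * b i) + \sum_(i | P i) b i ^+ 2.
  by rewrite mulr_sumr -!big_split /=; apply: eq_bigr => i _; ring.
lra.
Qed.

Lemma sum_expR_dist_recl k (z : R) : \sum_(i < k.+1) expR (- `|z - i%:R|) =
  expR (- `|z|) + \sum_(i < k) expR (- `|(z - 1) - i%:R|).
Proof.
rewrite big_ord_recl subr0; congr (_ + _); apply: eq_bigr => i _.
by congr (expR (- `|_|)); rewrite lift0 -natr1; ring.
Qed.

Lemma sum_expR_dist_le0 k (z : R) : z <= 0 ->
  \sum_(i < k) expR (- `|z - i%:R|) <= 2 * expR z.
Proof.
have ein : expR (-1) <= 1 / 2 :> R.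
  have := expR_ge1Dx (1 : R); rewrite expRN => e1.
  by rewrite -div1r ler_pM2l // lef_pV2 ?posrE ?expR_gt0 //; lra.
elim: k z => [|k IH] z z0; first by rewrite big_ord0 mulr_ge0 ?expR_ge0.
rewrite sum_expR_dist_recl ler0_norm // opprK.
have z1 : z - 1 <= 0 by lra.
have := IH _ z1; rewrite expRD.
have : expR z * expR (-1) <= expR z * (1 / 2) by rewrite ler_wpM2l ?expR_ge0.
lra.
Qed.

Lemma sum_expR_dist k (z : R) : \sum_(i < k) expR (- `|z - i%:R|) <= 4.
Proof.
have [z0|z0] := lerP z 0.
  apply: le_trans (sum_expR_dist_le0 k z0) _.
  by have : expR z <= 1; [rewrite expR_le1|lra].
suff : \sum_(i < k) expR (- `|z - i%:R|) <= 4 - expR (- z).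
  by have := expR_ge0 (- z); lra.
elim: k z {z0}(ltW z0) => [|k IH] z z0.
  by rewrite big_ord0; have : expR (- z) <= 1; [rewrite expR_le1 oppr_le0|lra].
rewrite sum_expR_dist_recl ger0_norm //.
have ez1 : expR (- z) <= 1 by rewrite expR_le1 oppr_le0.
have [z1|z1] := lerP z 1.
  have z1' : z - 1 <= 0 by lra.
  have := sum_expR_dist_le0 k z1'.
  have : expR (z - 1) <= 1 by rewrite expR_le1.
  lra.
have z1' : 0 <= z - 1 by lra.
have := IH _ z1'; rewrite opprB addrC expRD.
have := expR_ge1Dx (1 : R) => e1.
have : expR (- z) * 2 <= expR (- z) * expR 1 by rewrite ler_wpM2l ?expR_ge0 //; lra.
lra.
Qed.

Lemma sum_gauss_le k (z : R) : \sum_(i < k) expR (- (z - i%:R) ^+ 2) <= 8.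
Proof.
apply: (@le_trans _ _ (\sum_(i < k) 2 * expR (- `|z - i%:R|))); last first.
  by rewrite -mulr_sumr; have := sum_expR_dist k z; lra.
apply: ler_sum => i _; rewrite -[(z - _) ^+ 2]real_normK ?num_real //.
set t := `|_|; have e1 : expR (1 / 4) <= 2 :> R.
  rewrite -[leLHS]invrK -expRN -[leRHS]invrK lef_pV2 ?posrE ?expR_gt0 ?invr_gt0 //.
  by apply: le_trans (expR_ge1Dx _); lra.
apply: (@le_trans _ _ (expR (1 / 4 + - t))).
  by rewrite ler_expR; have := sqr_ge0 (t - 1 / 2); rewrite sqrrB; nra.
by rewrite expRD ler_wpM2r ?expR_ge0.
Qed.

End Minkowski.

(** * Characters of the circle *)

Section Characters.
Variable R : realType.

Definition cos_char (N : int) (theta : R) : R := cos (4 * pi * theta * N%:~R).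

Lemma cos_char_abs N theta : cos_char N theta = cos_char `|N|%N theta.
Proof.
rewrite /cos_char; case: N => k //=.
by rewrite NegzE mulrNz mulrN cosN.
Qed.

Lemma cos_char_periodic N theta : cos_char N (theta + 1) = cos_char N theta.
Proof.
rewrite !(cos_char_abs N) /cos_char; set k := `|N|%N.
rewrite -[RHS](periodicn (@cosD2pi R) (k * 2)); congr cos.
rewrite -[pi *+ 2 *+ (k * 2)]mulr_natr natrM -[k%:~R]/(k%:R). ring.
Qed.

Lemma continuous_cos_char N : continuous (cos_char N).
Proof.
move=> x; rewrite /cos_char; apply: continuous_comp; last exact: continuous_cos.
apply: continuousM; last exact: cst_continuous.
by apply: continuousM; [exact: cst_continuous|exact: cvg_id].
Qed.

(** For N != 0 the shift by half a period of the function changes its sign but not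
    its mean. *)
Lemma circle_mean_cos_char N :
  circle_mean (cos_char N) = (N == 0)%:R :> R.
Proof.
have [->|N0] := eqVneq N 0.
  rewrite (_ : cos_char 0 = fun=> 1) ?circle_mean_cst //.
  by apply/funext => x; rewrite /cos_char mulr0 cos0.
have -> : cos_char N = cos_char `|N|%N by apply/funext => x; exact: cos_char_abs.
have : (0 < `|N|)%N by rewrite absz_gt0.
move: `|N|%N => k k0 /=.
have kR : 1 <= k%:R :> R by rewrite ler1n.
pose c := (4 * k%:R)^-1 : R.
have c01 : 0 <= c <= 1.
  rewrite invr_ge0 invf_le1 ?mulr_gt0 ?mulr_ge0 //; try lra.
have := circle_mean_shift (@continuous_cos_char k) (cos_char_periodic k) c01.
have -> : (fun x => cos_char k (x + c)) = (fun x => -1 * cos_char k x).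
  apply/funext => x; rewrite /cos_char mulN1r -cosDpi; congr cos.
  by rewrite /c -[k%:~R]/(k%:R); field; rewrite gt_eqF //; lra.
rewrite circle_meanZ; last exact: continuous_cos_char.
lra.
Qed.

Lemma cisD (x y : R) : cis (x + y) = cis x * cis y.
Proof.
by apply/eqP; rewrite eq_complex /= cosD sinD; apply/andP; split; apply/eqP; ring.
Qed.

Lemma cis_sum (I : Type) (r : seq I) (F : I -> R) :
  cis (\sum_(i <- r) F i) = \prod_(i <- r) cis (F i).
Proof.
elim: r => [|i r IH]; last by rewrite !big_cons cisD IH.
by rewrite !big_nil; apply/eqP; rewrite eq_complex /= cos0 sin0 !eqxx.
Qed.

(** The sum of the characters exp (4 pi i theta (+- d j)) is real; its m-th power
    is expanded over words of length m, and the real part is taken. *)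
Lemma cos_char_sum_pow n (d : 'I_n -> int) (J : {set 'I_n}) (m : nat) theta :
  (\sum_(j in J) 2 * cos_char (d j) theta) ^+ m =
  \sum_(p : {ffun 'I_m -> bool} * {ffun 'I_m -> 'I_n} | [forall k, p.2 k \in J])
    cos_char (\sum_k (-1) ^+ p.1 k * d (p.2 k)) theta.
Proof.
pose t := 4 * pi * theta.
pose F (a : bool * 'I_n) : R[i] :=
  if a.2 \in J then cis (t * ((-1) ^+ a.1 * d a.2)%:~R) else 0.
have sumF : \sum_a F a = (\sum_(j in J) 2 * cos_char (d j) theta)%:C%C.
  transitivity (\sum_b \sum_j F (b, j)).
    by rewrite pair_big; apply: eq_bigr => -[].
  rewrite exchange_big rmorph_sum /= [RHS]big_mkcond; apply: eq_bigr => j _.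
  rewrite big_bool /F /=; case: ifP => _; last by rewrite addr0.
  rewrite expr0 expr1 mul1r mulN1r mulrNz mulrN /cis cosN sinN /cos_char -/t.
  apply/eqP; rewrite eq_complex /=.
  by apply/andP; split; apply/eqP; ring.
have : complex.Re ((\sum_a F a) ^+ m) =
    (\sum_(j in J) 2 * cos_char (d j) theta) ^+ m.
  by rewrite sumF -rmorphXn.
move=> <-.
have -> : (\sum_a F a) ^+ m = \prod_(k < m) \sum_a F a.
  by rewrite prodr_const card_ord.
rewrite bigA_distr_bigA /= raddf_sum /=.
rewrite (reindex (fun p : {ffun 'I_m -> bool} * {ffun 'I_m -> 'I_n} =>
  [ffun k => (p.1 k, p.2 k)])) /=; last first.
  exists (fun g : {ffun 'I_m -> bool * 'I_n} =>
    ([ffun k => (g k).1], [ffun k => (g k).2])) => [[p1 p2] _|g _] /=.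
    by congr (_, _); apply/ffunP => k; rewrite !ffunE.
  by apply/ffunP => k; rewrite !ffunE; case: (g k).
rewrite [RHS]big_mkcond; apply: eq_bigr => p _.
case: ifPn => [/forallP pJ|]; last first.
  rewrite negb_forall => /existsP[k pkJ].
  by rewrite (bigD1 k) //= /F ffunE /= (negbTE pkJ) mul0r.
rewrite (eq_bigr (fun k => cis (t * ((-1) ^+ p.1 k * d (p.2 k))%:~R))).
  by rewrite -cis_sum -mulr_sumr /= /cos_char -/t rmorph_sum.
by move=> k _; rewrite /F ffunE /= pJ.
Qed.

Lemma continuous_cos_char_sum n (d : 'I_n -> int) (J : {set 'I_n}) (c : R) :
  continuous (fun theta => \sum_(j in J) c * cos_char (d j) theta).
Proof.
have -> : (fun theta => \sum_(j in J) c * cos_char (d j) theta) =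
    (fun theta => \sum_j (if j \in J then c else 0) * cos_char (d j) theta).
  apply/funext => theta; rewrite big_mkcond; apply: eq_bigr => j _.
  by case: ifP; rewrite ?mul0r.
apply: (proj1 (circle_mean_sum _ _)) => j.
by apply: continuous_scale; exact: continuous_cos_char.
Qed.

(** By orthogonality the mean counts the words in the letters (+-, j), with j in
    J, whose signed sum of differences vanishes. *)
Lemma circle_mean_cos_char_pow_le n (A : two_cube n) (J : {set 'I_n}) (l : nat) :
  circle_mean (fun theta : R =>
    (\sum_(j in J) 2 * cos_char (cube_diff A j) theta) ^+ (2 * l)) <=
  (r_count A l)%:R.
Proof.
pose S (p : {ffun 'I_(2 * l) -> bool} * {ffun 'I_(2 * l) -> 'I_n}) :=
  \sum_k (-1) ^+ p.1 k * cube_diff A (p.2 k).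
have -> : (fun theta : R =>
    (\sum_(j in J) 2 * cos_char (cube_diff A j) theta) ^+ (2 * l)) =
  (fun theta => \sum_(p : {ffun 'I_(2 * l) -> bool} * {ffun 'I_(2 * l) -> 'I_n})
    ([forall k, p.2 k \in J]%:R * cos_char (S p) theta)).
  apply/funext => theta; rewrite cos_char_sum_pow big_mkcond.
  by apply: eq_bigr => p _; case: ifP; rewrite ?mul1r ?mul0r.
rewrite (proj2 (circle_mean_sum _ _)); last first.
  by move=> p; apply: continuous_scale; exact: continuous_cos_char.
rewrite /r_count -sum1_card natr_sum [leRHS]big_mkcond /=; apply: ler_sum => p _.
rewrite circle_meanZ; last exact: continuous_cos_char.
rewrite circle_mean_cos_char inE -/(S p).
by case: (S p == 0); case: [forall k, _]; rewrite /= ?mulr0 ?mul0r ?mulr1.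
Qed.

End Characters.

(** * Halasz's inequality *)

Section Halasz.
Variable R : realType.

(** Within constant factors, the sum over j in J of the squared distances of
    2 * theta * d j to the nearest integer. Its square root is subadditive in
    theta, being a Euclidean norm of sines. *)
Definition energy n (d : 'I_n -> int) (J : {set 'I_n}) (theta : R) : R :=
  \sum_(j in J) sin (2 * pi * theta * (d j)%:~R) ^+ 2.

Lemma cos_charE N (theta : R) :
  cos_char N theta = 1 - 2 * sin (2 * pi * theta * N%:~R) ^+ 2.
Proof.
rewrite /cos_char (_ : 4 * pi * theta * N%:~R = (2 * pi * theta * N%:~R) *+ 2).
  by rewrite cos_mulr2n cos2sin2 -mulr_natl; ring.
by rewrite -mulr_natl; ring.
Qed.

Section FixedSet.
Variables (n : nat) (d : 'I_n -> int) (J : {set 'I_n}).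
Local Notation E := (energy d J).
Local Notation m := (#|J|%:R : R).

Lemma cos_char_sum_energy theta :
  \sum_(j in J) 2 * cos_char (d j) theta = 2 * m - 4 * E theta.
Proof.
rewrite (eq_bigr (fun j => 2 - 4 * sin (2 * pi * theta * (d j)%:~R) ^+ 2)).
  by rewrite sumrB -mulr_sumr sumr_const mulr_natr.
by move=> j _; rewrite cos_charE; ring.
Qed.

Lemma energy_ge0 theta : 0 <= E theta.
Proof. by apply: sumr_ge0 => j _; exact: sqr_ge0. Qed.

Lemma energyE theta :
  E theta = m / 2 + \sum_(j in J) - (1 / 2) * cos_char (d j) theta.
Proof.
have := cos_char_sum_energy theta; rewrite -!mulr_sumr; lra.
Qed.

Lemma continuous_energy : continuous E.
Proof.
have -> : E = fun theta => m / 2 + \sum_(j in J) - (1 / 2) * cos_char (d j) theta.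
  by apply/funext => theta; exact: energyE.
by apply: continuous_shiftl; exact: continuous_cos_char_sum.
Qed.

Lemma energy_periodic theta : E (theta + 1) = E theta.
Proof.
rewrite !energyE; congr (_ + _); apply: eq_bigr => j _.
by rewrite cos_char_periodic.
Qed.

Lemma energy0 : E 0 = 0.
Proof. by apply: big1 => j _; rewrite mulr0 mul0r sin0 expr0n. Qed.

Lemma circle_mean_energy : (forall j, d j != 0) -> circle_mean E = m / 2.
Proof.
move=> d0; have -> : E = fun theta =>
    m / 2 + \sum_j (if j \in J then - (1 / 2) else 0) * cos_char (d j) theta.
  apply/funext => theta; rewrite energyE; congr (_ + _).
  by rewrite big_mkcond; apply: eq_bigr => j _; case: ifP; rewrite ?mul0r.
have cS j : continuous (fun theta : R =>
    (if j \in J then - (1 / 2) else 0) * cos_char (d j) theta).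
  by apply: continuous_scale; exact: continuous_cos_char.
have [cS' mS] := circle_mean_sum (index_enum _) cS.
rewrite circle_meanD //; last exact: cst_continuous.
rewrite circle_mean_cst mS big1 ?addr0 // => j _.
rewrite circle_meanZ; last exact: continuous_cos_char.
by rewrite circle_mean_cos_char (negbTE (d0 j)) mulr0.
Qed.

Lemma sqrt_energyD x y :
  Num.sqrt (E (x + y)) <= Num.sqrt (E x) + Num.sqrt (E y).
Proof.
pose s (z : R) j := `|sin (2 * pi * z * (d j)%:~R)|.
have EE z : E z = \sum_(j in J) s z j ^+ 2.
  by apply: eq_bigr => j _; rewrite real_normK ?num_real.
rewrite (EE x) (EE y); apply: le_trans (minkowski_sum _ _ _).
apply: ler_wsqrtr; apply: ler_sum => j _.
rewrite -[leLHS]real_normK ?num_real // ler_pXn2r ?nnegrE ?addr_ge0 ?normr_ge0 //.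
rewrite mulrDr mulrDl sinD; apply: le_trans (ler_normD _ _) _.
rewrite !normrM; apply: lerD.
  by rewrite ler_piMr ?normr_ge0 ?cos_max.
by rewrite ler_piMl ?normr_ge0 ?cos_max.
Qed.

Lemma energyN x : E (- x) = E x.
Proof.
by apply: eq_bigr => j _; rewrite mulrN mulNr sinN sqrrN.
Qed.

Lemma sqrt_energy_dist x y :
  `|Num.sqrt (E x) - Num.sqrt (E y)| <= Num.sqrt (E (x + y)).
Proof.
have h1 := sqrt_energyD (x + y) (- y); rewrite addrK energyN in h1.
have h2 := sqrt_energyD (x + y) (- x); rewrite addrC addKr energyN in h2.
by rewrite ler_norml; apply/andP; split; lra.
Qed.

(** Since its mean is m / 2, the energy is somewhere at least m / 4; it vanishes at 0,
    and the intermediate value theorem applies. *)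
Lemma energy_reaches t : (forall j, d j != 0) -> 0 <= t <= Num.sqrt m / 2 ->
  exists2 phi, 0 <= phi <= 1 & Num.sqrt (E phi) = t.
Proof.
move=> d0 /andP[t0 tm].
have [theta /andP[th0 th1] th] :
    exists2 theta, 0 <= theta <= 1 & m / 4 <= E theta.
  apply: contrapT => noE.
  have small x : 0 <= x <= 1 -> E x <= m / 4.
    by move=> x01; rewrite leNgt; apply/negP => h; apply: noE; exists x => //;
      exact: ltW.
  have := circle_mean_le continuous_energy (@cst_continuous _ _ (m / 4)) small.
  rewrite circle_mean_energy // circle_mean_cst => m0.
  by apply: noE; exists 0; rewrite ?lexx ?ler01 // energy0; lra.
have cE : continuous (fun x => Num.sqrt (E x)).
  by move=> x; apply: continuous_comp; [exact: continuous_energy|exact: sqrt_continuous].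
have [||phi] := @IVT R (fun x => Num.sqrt (E x)) 0 theta t th0.
- exact: continuous_subspaceT.
- rewrite energy0 sqrtr0 min_l ?sqrtr_ge0 // max_r ?sqrtr_ge0 // t0 /=.
  apply: le_trans tm _.
  by rewrite -sqrtr_quarter // ler_wsqrtr.
rewrite in_itv /= => /andP[p0 p1] phit; exists phi => //.
by rewrite p0 (le_trans p1).
Qed.

(** If the energy of theta is at most m / 4, the triangle inequality for the root of
    the energy bounds the summand i by exp (- (z - i) ^+ 2), with z the root of
    a * energy theta, and the sum of a Gaussian over integer shifts is bounded;
    the cosine sum is then at least m, so that its normalised power is at least
    1. Otherwise every translate has energy at least m / 16, because the roots of
    the energies of the phi i are at most Num.sqrt m / 4. *)
Lemma sum_translates_le k (phi : 'I_k -> R) (a : R) (l : nat) theta : 0 < a ->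
  (0 < #|J|)%N ->
  (forall i, Num.sqrt (E (phi i)) = i%:R / Num.sqrt a) ->
  (forall i : 'I_k, i%:R <= Num.sqrt (a * m) / 4) ->
  \sum_(i < k) expR (- (a * E (theta + phi i))) <=
  8 / m ^+ (2 * l) * (\sum_(j in J) 2 * cos_char (d j) theta) ^+ (2 * l) +
  k%:R * expR (- (a * m / 16)).
Proof.
move=> a0 J0 phiE kle; have m0 : 0 < m by rewrite ltr0n.
have sa0 : 0 < Num.sqrt a by rewrite sqrtr_gt0.
set G := \sum_(j in J) _.
have G0 : 0 <= G ^+ (2 * l) by rewrite exprM exprn_ge0 // sqr_ge0.
have [Em|Em] := lerP (E theta) (m / 4).
  apply: (@le_trans _ _ 8); last first.
    rewrite ler_wpDr ?mulr_ge0 ?expR_ge0 // mulrAC ler_pdivlMr ?exprn_gt0 //.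
    rewrite ler_wpM2l // lerXn2r ?nnegrE ?ler0n //; rewrite /G cos_char_sum_energy; lra.
  apply: le_trans (sum_gauss_le k (Num.sqrt a * Num.sqrt (E theta))).
  apply: ler_sum => i _; rewrite ler_expR lerN2.
  have /(lerXn2r 2) := sqrt_energy_dist theta (phi i).
  rewrite !nnegrE normr_ge0 sqrtr_ge0 => /(_ isT isT).
  rewrite sqr_sqrtr ?energy_ge0 // real_normK ?num_real // phiE.
  move=> /(ler_wpM2l (ltW a0)); apply: le_trans.
  rewrite -{2}[a](sqr_sqrtr (ltW a0)) -exprMn mulrBr.
  by rewrite (mulrC _ (_ / _)) divfK ?gt_eqF.
apply: (@le_trans _ _ (\sum_(i < k) expR (- (a * m / 16)))); last first.
  by rewrite sumr_const card_ord -[_ *+ k]mulr_natl lerDr mulr_ge0.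
apply: ler_sum => i _; rewrite ler_expR lerN2 -mulrA ler_wpM2l ?(ltW a0) //.
have sm0 : 0 <= Num.sqrt m by exact: sqrtr_ge0.
have big : Num.sqrt m / 2 <= Num.sqrt (E theta).
  by rewrite -sqrtr_quarter // ler_wsqrtr // ltW.
have small : Num.sqrt (E (phi i)) <= Num.sqrt m / 4.
  rewrite phiE ler_pdivrMr //; apply: le_trans (kle i) _.
  by rewrite sqrtrM ?(ltW a0) // [leRHS]mulrC mulrA.
have := ler_norm (Num.sqrt (E theta) - Num.sqrt (E (phi i))).
move=> /le_trans/(_ (sqrt_energy_dist theta (phi i))) dist.
have : (Num.sqrt m / 4) ^+ 2 <= Num.sqrt (E (theta + phi i)) ^+ 2.
  by rewrite lerXn2r ?nnegrE ?divr_ge0 ?sqrtr_ge0 //; lra.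
rewrite exprMn !sqr_sqrtr ?energy_ge0 // ?ler0n //.
by rewrite (_ : 4^-1 ^+ 2 = 16^-1) //; field.
Qed.

End FixedSet.

(** Halasz's inequality. The mean of exp (- a * energy) is the same for each of
    about Num.sqrt (a * m) translates, and by sum_translates_le their sum is
    essentially bounded on the set of small energy, whose measure is controlled
    by the (2 * l)-th moment of the cosine sum. *)
Lemma halasz n (A : two_cube n) (J : {set 'I_n}) (a : R) (l : nat) :
  0 < a -> (0 < #|J|)%N ->
  circle_mean (fun theta => expR (- (a * energy (cube_diff A) J theta))) <=
  32 / Num.sqrt (a * #|J|%:R) * ((r_count A l)%:R / #|J|%:R ^+ (2 * l)) +
  expR (- (a * #|J|%:R / 16)).
Proof.
move=> a0 J0; set m : R := #|J|%:R; have m0 : 0 < m by rewrite ltr0n.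
have d0 j : cube_diff A j != 0 by rewrite subr_eq0 (cube_neq A j).
have sa0 : 0 < Num.sqrt a by rewrite sqrtr_gt0.
have sam0 : 0 < Num.sqrt (a * m) by rewrite sqrtr_gt0 mulr_gt0.
set E := energy (cube_diff A) J.
have cE : continuous E by exact: continuous_energy.
pose h theta := expR (- (a * E theta)).
have ch : continuous h.
  move=> x; apply: continuous_comp; last exact: continuous_expR.
  by apply: continuousN; apply: continuous_scale.
have hper x : h (x + 1) = h x by rewrite /h /E energy_periodic.
(* k is the number of integers i >= 0 with i / sqrt a <= sqrt m / 4. *)
pose k := (Num.truncn (Num.sqrt (a * m) / 4)).+1.
have ile (i : 'I_k) : i%:R <= Num.sqrt (a * m) / 4.
  have /andP[+ _] := truncn_itv (divr_ge0 (ltW sam0) (ler0n _ 4)).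
  by apply: le_trans; rewrite ler_nat -ltnS.
have kge : Num.sqrt (a * m) / 4 <= k%:R by apply: ltW; exact: truncnS_gt.
have /fin_all_exists2[phi phi01 phiE] : forall i : 'I_k,
    exists2 phi, 0 <= phi <= 1 & Num.sqrt (E phi) = i%:R / Num.sqrt a.
  move=> i; apply: energy_reaches => //; rewrite divr_ge0 ?sqrtr_ge0 //=.
  rewrite ler_pdivrMr //; apply: le_trans (ile i) _.
  rewrite sqrtrM ?(ltW a0) //.
  by have := mulr_ge0 (ltW sa0) (sqrtr_ge0 m); rewrite -/m; lra.
have ct i : continuous (fun theta => h (theta + phi i)).
  move=> x; apply: continuous_comp; last exact: ch.
  by apply: continuousD; [exact: cvg_id|exact: cst_continuous].
have [cS mS] := circle_mean_sum (index_enum 'I_k) ct.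
have cG : continuous (fun theta : R =>
    (\sum_(j in J) 2 * cos_char (cube_diff A j) theta) ^+ (2 * l)).
  move=> x; apply: (@continuous_comp _ _ _ (fun theta : R =>
    \sum_(j in J) 2 * cos_char (cube_diff A j) theta) (fun z => z ^+ (2 * l))).
    exact: continuous_cos_char_sum.
  exact: exprn_continuous.
have cG' := @continuous_scale R (8 / m ^+ (2 * l)) _ cG.
have pointwise x : 0 <= x <= 1 -> \sum_(i < k) h (x + phi i) <=
    k%:R * expR (- (a * m / 16)) + 8 / m ^+ (2 * l) *
      (\sum_(j in J) 2 * cos_char (cube_diff A j) x) ^+ (2 * l).
  by move=> _; rewrite addrC; exact: sum_translates_le.
have := circle_mean_le cS (@continuous_shiftl R _ _ cG') pointwise.
rewrite mS (eq_bigr (fun=> circle_mean h)); last first.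
  by move=> i _; exact: circle_mean_shift.
rewrite sumr_const card_ord circle_meanD //; last exact: cst_continuous.
rewrite circle_mean_cst circle_meanZ // -[_ *+ k]mulr_natl => le_mean.
have k0 : 0 < k%:R :> R by rewrite ltr0n.
have M0 : 0 < m ^+ (2 * l) by rewrite exprn_gt0.
rewrite -(ler_pM2l k0); apply: le_trans le_mean _.
rewrite mulrDr addrC lerD2r.
apply: (@le_trans _ _ (8 / m ^+ (2 * l) * (r_count A l)%:R)).
  rewrite ler_wpM2l ?divr_ge0 ?(ltW M0) //.
  exact: circle_mean_cos_char_pow_le.
rewrite [leLHS](_ : _ = 8 * ((r_count A l)%:R / m ^+ (2 * l))); last by ring.
rewrite [leRHS]mulrA ler_wpM2r ?divr_ge0 ?(ltW M0) //.
rewrite mulrA ler_pdivlMr //; lra.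
Qed.

End Halasz.

(** * The infimum over the moments *)

Section HalaszInfimum.
Variable R : realType.

Lemma R_C_ge0 n (A : two_cube n) (C : R) : 0 <= C -> 0 <= R_C A C.
Proof.
move=> C0; apply: lb_le_inf.
  by exists (R_Cl A C 1); exists 1%N.
move=> _ [l _ <-]; rewrite /R_Cl addr_ge0 ?expR_ge0 //.
by rewrite divr_ge0 ?powR_ge0 // mulr_ge0 // exprn_ge0.
Qed.

(** The constants in C absorb the density kappa of J: passing from J to all the
    coordinates costs a factor kappa^-1 ^+ (2 * l), which is part of C ^+ l. *)
Lemma halasz_R_C n (A : two_cube n) (J : {set 'I_n}) (kappa e nu C : R) :
  (0 < n)%N -> 0 < kappa -> 0 < e -> 0 < nu -> kappa * n%:R <= #|J|%:R ->
  16 / (e * kappa) <= C ->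
  kappa^-1 ^+ 2 * (1 + 50 * 32 / Num.sqrt (e * kappa)) <= C ->
  circle_mean (fun theta =>
    expR (- (e * nu * energy (cube_diff A) J theta))) <=
  expR (- (nu * n%:R / C)) + R_C A C / (50 * Num.sqrt nu).
Proof.
move=> n0 k0 e0 nu0 Jk C1 C2; set H := circle_mean _.
have nR : 0 < n%:R :> R by rewrite ltr0n.
have kn0 : 0 < kappa * n%:R by rewrite mulr_gt0.
have m0 : 0 < #|J|%:R :> R by apply: lt_le_trans Jk.
have C0 : 0 < C by apply: lt_le_trans C1; rewrite divr_gt0 ?mulr_gt0.
have snu0 : 0 < Num.sqrt nu by rewrite sqrtr_gt0.
have sek0 : 0 < Num.sqrt (e * kappa) by rewrite sqrtr_gt0 mulr_gt0.
have sn0 : 0 < Num.sqrt (n%:R : R) by rewrite sqrtr_gt0.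
rewrite -lerBlDl ler_pdivlMr ?mulr_gt0 //; apply: lb_le_inf.
  by exists (R_Cl A C 1); exists 1%N.
move=> _ [l /= l1 <-]; rewrite /R_Cl.
rewrite powRD ?gt_eqF ?implybT // powR_mulrn ?(ltW nR) // powR12_sqrt ?(ltW nR) //.
rewrite -ler_pdivlMr ?mulr_gt0 //.
have J0 : (0 < #|J|)%N by rewrite -(ltr0n R).
have a0 : 0 < e * nu by rewrite mulr_gt0.
have hal := halasz A l a0 J0; rewrite -/H in hal.
set r : R := (r_count A l)%:R in hal *; have r0 : 0 <= r by [].
have tail : expR (- (e * nu * #|J|%:R / 16)) <= expR (- (nu * n%:R / C)).
  rewrite ler_expR lerN2.
  apply: (@le_trans _ _ (e * nu * (kappa * n%:R) / 16)); last first.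
    by rewrite ler_wpM2r // ler_wpM2l // ltW.
  rewrite [leRHS](_ : _ = nu * n%:R * (16 / (e * kappa))^-1); last first.
    by field; rewrite !gt_eqF.
  by rewrite ler_wpM2l ?mulr_ge0 ?(ltW nu0) // lef_pV2 ?posrE // divr_gt0 ?mulr_gt0.
have Cl : kappa^-1 ^+ (2 * l) * (50 * 32 / Num.sqrt (e * kappa)) <= C ^+ l.
  set G := 50 * 32 / _ in C2 *.
  have G0 : 0 <= G by rewrite divr_ge0 ?mulr_ge0 ?ler0n ?(ltW sek0).
  apply: (@le_trans _ _ ((kappa^-1 ^+ 2 * (1 + G)) ^+ l)); last first.
    by rewrite lerXn2r ?nnegrE ?(ltW C0) // mulr_ge0 ?sqr_ge0 // addr_ge0.
  rewrite exprMn -exprM ler_wpM2l ?exprn_ge0 ?invr_ge0 ?(ltW k0) //.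
  case: l l1 {hal r r0} => // l _; rewrite exprS.
  have G1 : 1 <= (1 + G) ^+ l by rewrite exprn_ege1 // lerDl.
  by have := ler_wpM2l (addr_ge0 ler01 G0) G1; lra.
have main : 32 / Num.sqrt (e * nu * #|J|%:R) * (r / #|J|%:R ^+ (2 * l)) <=
    C ^+ l * r / (n%:R ^+ (2 * l) * Num.sqrt n%:R) / (50 * Num.sqrt nu).
  apply: (@le_trans _ _ (32 / Num.sqrt (e * nu * (kappa * n%:R)) *
      (r / (kappa * n%:R) ^+ (2 * l)))).
    apply: ler_pM; rewrite ?divr_ge0 ?sqrtr_ge0 ?exprn_ge0 ?(ltW m0) //.
      rewrite ler_pM2l // lef_pV2 ?posrE ?sqrtr_gt0 ?mulr_gt0 //.
      by rewrite ler_wsqrtr // ler_wpM2l // ltW.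
    rewrite ler_wpM2l // lef_pV2 ?posrE ?exprn_gt0 //.
    by rewrite lerXn2r ?nnegrE // ltW.
  have -> : Num.sqrt (e * nu * (kappa * n%:R)) =
      Num.sqrt (e * kappa) * Num.sqrt nu * Num.sqrt n%:R.
    rewrite -!sqrtrM ?mulr_ge0 ?(ltW e0) ?(ltW k0) ?(ltW nu0) //.
    by congr Num.sqrt; ring.
  rewrite [leLHS](_ : _ = kappa^-1 ^+ (2 * l) * (50 * 32 / Num.sqrt (e * kappa)) *
    (r / (n%:R ^+ (2 * l) * Num.sqrt n%:R) / (50 * Num.sqrt nu))); last first.
    rewrite exprMn exprVn; field.
    by rewrite !gt_eqF ?exprn_gt0.
  rewrite [leRHS](_ : _ = C ^+ l *
    (r / (n%:R ^+ (2 * l) * Num.sqrt n%:R) / (50 * Num.sqrt nu))); last by ring.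
  by rewrite ler_wpM2r // !divr_ge0 ?mulr_ge0 ?exprn_ge0 ?(ltW nR) ?(ltW sn0).
have extra : 0 <= expR (- (n%:R / C)) / (50 * Num.sqrt nu).
  by rewrite divr_ge0 ?expR_ge0 // mulr_ge0 // ltW.
rewrite mulrDl; lra.
Qed.

End HalaszInfimum.

(** * The characteristic function *)

Section CharAbs.
Variable R : realType.
Local Notation normc := (@ComplexField.Normc.normc R).

Definition phase_kernel n (A : two_cube n) (theta : R) (i : 'I_n)
    (b c : bool) : R[i] :=
  cis (2 * pi * theta *
    ((if b then cube_u A i else cube_v A i) * (-1) ^+ c)%:~R).

Lemma normc_cis (t : R) : normc (cis t) = 1.
Proof. by rewrite /= cos2Dsin2 sqrtr1. Qed.

(** The relative phases are exp (- 4 pi i theta u) and exp (- 4 pi i theta v), whose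
    sum has modulus 2 * |cos (2 pi theta (u - v))|. *)
Lemma phase_kernel_dephasing n (A : two_cube n) theta i :
  dephasing (sin (2 * pi * theta * (cube_diff A i)%:~R) ^+ 2)
    (phase_kernel A theta i).
Proof.
split=> [b c|]; first exact: normc_cis.
set s := sin _.
set x := 2 * pi * theta * (cube_u A i)%:~R.
set y := 2 * pi * theta * (cube_v A i)%:~R.
have sE : s ^+ 2 = 1 - cos (x - y) ^+ 2.
  rewrite cos2sin2 /s /x /y /cube_diff -mulrBr -intrB.
  by set S := sin _; ring.
have s1 : s ^+ 2 <= 1 by rewrite sE gerBl sqr_ge0.
have s0 := sqr_ge0 s.
rewrite -(@ler_pXn2r _ 2) ?nnegrE ?normc_ge0 //; last by lra.
have cE (t : R) : cis (- t) * (cis t)^*%C = cis (- (t *+ 2)).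
  have -> : (cis t)^*%C = cis (- t) by rewrite /cis /= cosN sinN.
  by rewrite -cisD mulr2n opprD.
have kernelE b : phase_kernel A theta i b true * (phase_kernel A theta i b false)^*%C
    = cis (- ((if b then x else y) *+ 2)).
  by rewrite -cE /phase_kernel expr0 expr1 mulr1 mulrN1 mulrNz mulrN; case: b.
rewrite !kernelE sqr_normc /= !cosN !sinN.
have -> : (cos (x *+ 2) + cos (y *+ 2)) ^+ 2 + (- sin (x *+ 2) - sin (y *+ 2)) ^+ 2
    = (cos (x *+ 2) ^+ 2 + sin (x *+ 2) ^+ 2) +
      (cos (y *+ 2) ^+ 2 + sin (y *+ 2) ^+ 2) +
      2 * (cos (x *+ 2) * cos (y *+ 2) + sin (x *+ 2) * sin (y *+ 2)) by ring.
rewrite !cos2Dsin2 -cosB -mulrnBl cos_mulr2n.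
have -> : cos (x - y) ^+ 2 = 1 - s ^+ 2 by rewrite sE; ring.
have := sqr_ge0 (s ^+ 2); rewrite -mulr_natr; nra.
Qed.

Lemma char_abs_twisted_sum n (A : two_cube n) (B : {set sign_cube n}) b theta :
  char_abs B (cube_vertex A b) theta =
  normc (twisted_sum (phase_kernel A theta)
    (fun y => (y \in B)%:R / #|B|%:R) b).
Proof.
rewrite /char_abs /unif_mean /twisted_sum; congr (normc _).
rewrite mulr_suml [LHS]big_mkcond; apply: eq_bigr => y _.
case: (y \in B); last by rewrite !mul0r.
rewrite mul1r mulrC fmorphV rmorph_nat; congr (_ * _).
rewrite /dotz rmorph_sum mulr_sumr cis_sum; apply: eq_bigr => i _.
by rewrite !ffunE.
Qed.

Lemma char_absE n (B : {set sign_cube n}) x (theta : R) :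
  char_abs B x theta = (#|B|%:R)^-1 * Num.sqrt (
    (\sum_(y <- enum B) cos (2 * pi * theta * (dotz x (sign_vec y))%:~R)) ^+ 2 +
    (\sum_(y <- enum B) sin (2 * pi * theta * (dotz x (sign_vec y))%:~R)) ^+ 2).
Proof.
rewrite /char_abs /unif_mean ComplexField.Normc.normcM mulrC; congr (_ * _).
  by rewrite -(rmorph_nat (real_complex R)) -fmorphV normc_real ?invr_ge0.
rewrite -[LHS]ger0_norm ?normc_ge0 // -sqrtr_sqr sqr_normc; congr Num.sqrt.
by rewrite raddf_sum /= raddf_sum /= !big_enum.
Qed.

Lemma char_abs_ge0 n (B : {set sign_cube n}) x (theta : R) :
  0 <= char_abs B x theta.
Proof. exact: normc_ge0. Qed.

Lemma char_abs_le1 n (B : {set sign_cube n}) x (theta : R) :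
  char_abs B x theta <= 1.
Proof.
rewrite /char_abs /unif_mean ComplexField.Normc.normcM.
rewrite -(rmorph_nat (real_complex R)) -fmorphV normc_real ?invr_ge0 //.
have : normc (\sum_(y in B)
    cis (2 * pi * theta * (dotz x (sign_vec y))%:~R)) <= #|B|%:R.
  rewrite -sum1_card natr_sum; elim/big_rec2: _ => [|y c z _ le_zc].
    by rewrite ComplexField.Normc.normc0.
  apply: le_trans (complex.le_normcD _ _) _.
  by rewrite normc_cis lerD2l.
have [->|B0] := posnP #|B|; first by rewrite invr0 mulr0.
by rewrite ler_pdivrMr ?ltr0n // mul1r.
Qed.

Lemma continuous_trig_sum (f : R -> R) n (B : {set sign_cube n}) x :
  continuous f -> continuous (fun theta : R =>
    (\sum_(y <- enum B) f (2 * pi * theta * (dotz x (sign_vec y))%:~R)) ^+ 2).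
Proof.
move=> cf t; apply: (@continuous_comp _ _ _ (fun theta : R =>
    \sum_(y <- enum B) f (2 * pi * theta * (dotz x (sign_vec y))%:~R))
    (fun z => z ^+ 2)); last exact: exprn_continuous.
apply: (proj1 (circle_mean_sum _ _)) => y {}t.
apply: continuous_comp; last exact: cf.
apply: continuousM; last exact: cst_continuous.
by apply: continuousM; [exact: cst_continuous|exact: cvg_id].
Qed.

Lemma continuous_char_abs n (B : {set sign_cube n}) x :
  continuous (@char_abs R n B x).
Proof.
have -> : char_abs B x = fun theta : R => (#|B|%:R)^-1 * Num.sqrt (
    (\sum_(y <- enum B) cos (2 * pi * theta * (dotz x (sign_vec y))%:~R)) ^+ 2 +
    (\sum_(y <- enum B) sin (2 * pi * theta * (dotz x (sign_vec y))%:~R)) ^+ 2).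
  by apply/funext => theta; exact: char_absE.
apply: continuous_scale => t; apply: continuous_comp; last exact: sqrt_continuous.
apply: continuousD; apply: continuous_trig_sum.
  exact: continuous_cos.
exact: continuous_sin.
Qed.

Lemma mean_char_absE n (B : {set sign_cube n}) x :
  mean_char_abs R B x = (circle_mean (char_abs B x))%:E.
Proof.
rewrite /mean_char_abs unlock integral_uniform.
- rewrite subr0 invr1 mul1e /circle_mean /Rintegral fineK //.
  apply: integrable_fin_num => //.
  by apply: continuous_integrable_segment; exact: continuous_char_abs.
- apply/measurable_EFinP; apply: continuous_measurable_fun.
  exact: continuous_char_abs.
- by move=> t; rewrite lee_fin char_abs_ge0.
Qed.

Lemma jensen_circle_mean (f G : R -> R) (p : R) : 1 <= p ->
  continuous f -> continuous G -> (forall x, 0 <= f x) ->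
  (forall x, f x `^ p <= G x) -> circle_mean f `^ p <= circle_mean G.
Proof.
move=> p1 cf cG f0 fG; set M := circle_mean f.
have M0 : 0 <= M by exact: circle_mean_ge0.
have p0 : 0 < p by lra.
have : circle_mean (fun x => M `^ (p - 1) * f x) <=
    circle_mean (fun x => M `^ p * (1 - p^-1) + p^-1 * G x).
  apply: circle_mean_le; [exact: continuous_scale| |].
    by apply: continuous_shiftl; exact: continuous_scale.
  move=> x _; rewrite mulrC; apply: le_trans (tangent_powR p1 (f0 x) M0) _.
  by rewrite addrC lerD2l mulrC ler_wpM2l // invr_ge0 ltW.
rewrite circle_meanZ // circle_meanD; [|exact: cst_continuous|exact: continuous_scale].
rewrite circle_mean_cst circle_meanZ // -/M mulrC mulr_powRB1 // => le1.
have : p^-1 * M `^ p <= p^-1 * circle_mean G by lra.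
by rewrite ler_pM2l // invr_gt0.
Qed.

End CharAbs.

(** * Averaging over the two sources *)

Section Average.
Variable R : realType.
Local Notation cube n := {ffun 'I_n -> bool}.
Local Notation rt := ((Num.sqrt 2)^-1 : R).

Definition unif (T : finType) (B : {set T}) (y : T) : R :=
  (y \in B)%:R / #|B|%:R.

Lemma unif_ge0 (T : finType) (B : {set T}) y : 0 <= unif B y.
Proof. by rewrite divr_ge0. Qed.

Lemma sum_unif (T : finType) (B : {set T}) : (0 < #|B|)%N -> \sum_y unif B y = 1.
Proof.
move=> B0; rewrite -mulr_suml -natr_sum -big_mkcond /= sum1_card divff //.
by rewrite pnatr_eq0 -lt0n.
Qed.

Lemma sqrt_unif_le (T : finType) (B : {set T}) y :
  Num.sqrt (unif B y) <= (Num.sqrt #|B|%:R)^-1.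
Proof.
rewrite -sqrtrV //; apply: ler_wsqrtr.
by rewrite /unif; case: (y \in B); rewrite ?mul1r // mul0r invr_ge0.
Qed.

Lemma entropy_unif n (B : {set cube n}) (f : cube n -> nat) (c : R) :
  (0 < #|B|)%N ->
  \sum_y Num.sqrt (unif B y) * rt ^+ f y <= c * Num.sqrt (\sum_y unif B y) ->
  \sum_y unif B y * rt ^+ f y <= c / Num.sqrt #|B|%:R.
Proof.
move=> B0; rewrite sum_unif // sqrtr1 mulr1 => le_c.
have s0 : 0 <= (Num.sqrt #|B|%:R)^-1 :> R by rewrite invr_ge0 sqrtr_ge0.
rewrite mulrC; apply: le_trans (ler_wpM2l s0 le_c); rewrite mulr_sumr.
apply: ler_sum => y _; rewrite mulrA ler_wpM2r ?exprn_ge0 ?invr_ge0 ?sqrtr_ge0 //.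
rewrite -[leLHS](sqr_sqrtr (unif_ge0 B y)) expr2.
by rewrite ler_wpM2r ?sqrtr_ge0 // sqrt_unif_le.
Qed.

(** Two subsets of 'I_n which meet in fewer than kappa * n points have sizes adding
    up to at most (1 + kappa) * n; the right hand side is at least 1 in
    that case, and factorises over the two sets. *)
Lemma few_common_free n (a b : 'I_n -> bool) (kappa : R) :
  #|[set i | a i && b i]|%:R < kappa * n%:R ->
  1 <= 2 `^ ((1 + kappa) * n%:R / 2) * (rt ^+ (\sum_i a i) * rt ^+ (\sum_i b i)).
Proof.
move=> few; rewrite -exprD -powR12_sqrt //.
set N := (\sum_i a i + \sum_i b i)%N.
have leN : (N <= n + #|[set i | a i && b i]|)%N.
  have -> : #|[set i | a i && b i]| = (\sum_i (a i && b i))%N.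
    rewrite -sum1_card big_mkcond; apply: eq_bigr => i _; rewrite inE.
    by case: (a i && b i).
  rewrite -[X in (X + _)%N](card_ord n) -sum1_card /N -!big_split.
  apply: leq_sum => i _ /=.
  by case: (a i); case: (b i).
have : N%:R <= n%:R + #|[set i | a i && b i]|%:R :> R by rewrite -natrD ler_nat.
rewrite -powRN -powR_mulrn ?powR_ge0 // -powRrM -powRD; last first.
  by rewrite pnatr_eq0 implybT.
move=> leN'; apply: le_trans (ler_powR _ (_ : 0 <= _)).
  by rewrite powRr0.
  by lra.
lra.
Qed.

(** By two_source_bound and Jensen's inequality, the left hand side is at most the
    mean over x in S and y in B of the Halasz integral of the set J of common
    free coordinates. The pairs with #|J| < delta / 2 * n have total weight
    at most expR (- (nu * n / C)) by the entropy bounds, since the entropies of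
    the two uniform distributions add up to at least (1 + delta) * n; the
    other pairs are handled by halasz_R_C. *)
Lemma two_source_circle_mean n (A : two_cube n) (B S : {set sign_cube n})
    (delta l nu C : R) :
  (0 < n)%N -> 0 < delta -> 0 < l <= 1 -> 1 + l <= 2 `^ (delta / 16) ->
  0 < nu <= 1 -> (0 < #|B|)%N -> (0 < #|S|)%N ->
  2 `^ (n%:R * (1 + delta)) <= #|B|%:R * #|S|%:R ->
  8 / (delta * ln 2) <= C ->
  16 / (l ^+ 4 / 64 * (delta / 2)) <= C ->
  (delta / 2)^-1 ^+ 2 * (1 + 50 * 32 / Num.sqrt (l ^+ 4 / 64 * (delta / 2))) <= C ->
  circle_mean (fun theta => \sum_x unif S x * char_abs B (cube_vertex A x) theta)
    `^ ((1 + nu) ^+ 2) <=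
  3 * expR (- (nu * n%:R / C)) + R_C A C / (50 * Num.sqrt nu).
Proof.
move=> n0 d0 /andP[l0 l1] lpow nu01 B0 S0 BS C1 C2 C3.
have /andP[nu0 nu1] := nu01.
have nR : 0 < n%:R :> R by rewrite ltr0n.
have ln2 : 0 < ln 2 :> R by rewrite ln_gt0 // ltr1n.
have C0 : 0 < C by apply: lt_le_trans C1; rewrite divr_gt0 ?mulr_gt0.
have d20 : 0 < delta / 2 by rewrite divr_gt0.
have e0 : 0 < l ^+ 4 / 64 by rewrite divr_gt0 ?exprn_gt0.
set p := unif B; set q := unif S.
pose J y x := [set i | free_given_past (l ^+ 2) p y i &&
                       free_given_future (l ^+ 2) q x i].
pose h y x theta :=
  expR (- (l ^+ 4 / 64 * nu * energy (cube_diff A) (J y x) theta)).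
have ch y x : continuous (h y x).
  move=> t; apply: continuous_comp; last exact: continuous_expR.
  by apply: continuousN; apply: continuous_scale; exact: continuous_energy.
have l201 : 0 <= l ^+ 2 <= 1 by rewrite sqr_ge0 expr_le1 // ltW.
have pointwise theta :
    (\sum_x q x * char_abs B (cube_vertex A x) theta) `^ ((1 + nu) ^+ 2) <=
    \sum_x \sum_y q x * p y * h y x theta.
  under eq_bigr do rewrite char_abs_twisted_sum.
  pose s i := sin (2 * pi * theta * (cube_diff A i)%:~R) ^+ 2.
  have s01 i : 0 <= s i <= 1 by rewrite sqr_ge0 /s sin2cos2 gerBl sqr_ge0.
  apply: le_trans (two_source_bound l201 nu01 s01
    (phase_kernel_dephasing A theta) (unif_ge0 B) (unif_ge0 S)
    (sum_unif B0) (sum_unif S0)) _.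
  apply: ler_sum => x _; apply: ler_sum => y _; rewrite ler_wpM2l //.
    by rewrite mulr_ge0 ?unif_ge0.
  rewrite /h -exprM ler_expR lerN2 ler_wpM2l ?mulr_ge0 ?(ltW nu0) ?(ltW l0) //.
  rewrite /energy big_mkcond; apply: ler_sum => i _; rewrite inE.
  by case: ifP => _; rewrite ?mulr1 ?mulr0.
have cf : continuous (fun theta : R =>
    \sum_x q x * char_abs B (cube_vertex A x) theta).
  apply: (proj1 (circle_mean_sum _ _)) => x.
  by apply: continuous_scale; exact: continuous_char_abs.
have cy x : continuous (fun theta => \sum_y q x * p y * h y x theta) /\
    circle_mean (fun theta => \sum_y q x * p y * h y x theta) =
    \sum_y q x * p y * circle_mean (h y x).
  have cyy y : continuous (fun theta => q x * p y * h y x theta).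
    by apply: continuous_scale.
  have [H1 H2] := circle_mean_sum (index_enum _) cyy; split=> //.
  by rewrite H2; apply: eq_bigr => y _; rewrite circle_meanZ.
have [cG meanG] := circle_mean_sum (index_enum _) (fun x => proj1 (cy x)).
have r1 : 1 <= (1 + nu) ^+ 2 by rewrite exprn_ege1 // lerDl ltW.
have f0 theta : 0 <= \sum_x q x * char_abs B (cube_vertex A x) theta.
  by apply: sumr_ge0 => x _; rewrite mulr_ge0 ?unif_ge0 ?char_abs_ge0.
apply: le_trans (jensen_circle_mean r1 cf cG f0 pointwise) _.
rewrite meanG (eq_bigr _ (fun x _ => proj2 (cy x))).
pose a y := (\sum_i free_given_past (l ^+ 2) p y i)%N.
pose b x := (\sum_i free_given_future (l ^+ 2) q x i)%N.
set D := 2 `^ ((1 + delta / 2) * n%:R / 2).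
set T := expR (- (nu * n%:R / C)) + R_C A C / (50 * Num.sqrt nu).
have T0 : 0 <= T.
  by rewrite addr_ge0 ?expR_ge0 // divr_ge0 ?R_C_ge0 ?(ltW C0) ?mulr_ge0 ?sqrtr_ge0.
have pair y x : circle_mean (h y x) <= D * (rt ^+ a y * rt ^+ b x) + T.
  have W0 : 0 <= D * (rt ^+ a y * rt ^+ b x).
    by rewrite !mulr_ge0 ?powR_ge0 ?exprn_ge0 ?invr_ge0 ?sqrtr_ge0.
  have [many|few] := lerP (delta / 2 * n%:R) #|J y x|%:R.
    apply: (@le_trans _ _ T); last by rewrite lerDr.
    exact: (halasz_R_C A n0 d20 e0 nu0 many C2 C3).
  apply: (@le_trans _ _ 1); last first.
    by apply: le_trans (few_common_free few) _; rewrite lerDl.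
  rewrite -[leRHS](circle_mean_cst (1 : R)); apply: circle_mean_le => //.
    exact: cst_continuous.
  move=> t _; rewrite /h expR_le1 oppr_le0 mulr_ge0 ?energy_ge0 //.
  by rewrite mulr_ge0 ?(ltW nu0) ?(ltW e0).
have split_le : \sum_x \sum_y q x * p y * circle_mean (h y x) <=
    D * ((\sum_y p y * rt ^+ a y) * (\sum_x q x * rt ^+ b x)) + T.
  have -> : T = \sum_x \sum_y q x * p y * T.
    under eq_bigr do rewrite -mulr_suml -mulr_sumr sum_unif // mulr1.
    by rewrite -mulr_suml sum_unif // mul1r.
  have -> : D * ((\sum_y p y * rt ^+ a y) * (\sum_x q x * rt ^+ b x)) =
      \sum_x \sum_y q x * p y * (D * (rt ^+ a y * rt ^+ b x)).
    rewrite [X in D * X]mulrC mulr_suml mulr_sumr; apply: eq_bigr => x _.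
    rewrite !mulr_sumr; apply: eq_bigr => y _.
    by move: (rt ^+ a y) (rt ^+ b x) => u v; ring.
  rewrite -big_split /=; apply: ler_sum => x _.
  rewrite -big_split /=; apply: ler_sum => y _.
  by rewrite -mulrDr ler_wpM2l // mulr_ge0 ?unif_ge0.
apply: le_trans split_le _.
have sl : Num.sqrt (l ^+ 2) = l by rewrite sqrtr_sqr ger0_norm // ltW.
have Ea : \sum_y p y * rt ^+ a y <= (1 + l) ^+ n / Num.sqrt #|B|%:R.
  apply: entropy_unif => //; rewrite -[X in (1 + X) ^+ n]sl.
  by apply: entropy_past; [exact: sqr_ge0|exact: unif_ge0].
have Eb : \sum_x q x * rt ^+ b x <= (1 + l) ^+ n / Num.sqrt #|S|%:R.
  apply: entropy_unif => //; rewrite -[X in (1 + X) ^+ n]sl.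
  by apply: entropy_future; [exact: sqr_ge0|exact: unif_ge0].
have sum0 (f : sign_cube n -> R) g : (forall y, 0 <= f y) ->
    0 <= \sum_y f y * rt ^+ g y.
  move=> f00; apply: sumr_ge0 => y _.
  by rewrite mulr_ge0 // exprn_ge0 // invr_ge0 sqrtr_ge0.
have D0 : 0 <= D by exact: powR_ge0.
suff bad : D * ((1 + l) ^+ n / Num.sqrt #|B|%:R * ((1 + l) ^+ n / Num.sqrt #|S|%:R))
    <= expR (- (nu * n%:R / C)).
  have := ler_wpM2l D0 (ler_pM (sum0 _ _ (unif_ge0 B)) (sum0 _ _ (unif_ge0 S)) Ea Eb).
  by have := expR_ge0 (- (nu * n%:R / C)); rewrite /T; lra.
have ll : (1 + l) ^+ n <= 2 `^ (delta / 16 * n%:R).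
  rewrite powRrM powR_mulrn ?powR_ge0 // lerXn2r ?nnegrE ?powR_ge0 //.
  by rewrite addr_ge0 // ltW.
have BSs : 2 `^ (n%:R * (1 + delta) / 2) <= Num.sqrt #|B|%:R * Num.sqrt #|S|%:R.
  by rewrite -sqrtrM // powRrM powR12_sqrt ?powR_ge0 // ler_wsqrtr.
have sBS : 0 < Num.sqrt #|B|%:R * Num.sqrt #|S|%:R :> R.
  by rewrite mulr_gt0 ?sqrtr_gt0 ?ltr0n.
apply: (@le_trans _ _ (2 `^ (- (delta / 8 * n%:R)))).
  rewrite [leLHS](_ : _ = D * ((1 + l) ^+ n * (1 + l) ^+ n) /
      (Num.sqrt #|B|%:R * Num.sqrt #|S|%:R)); last first.
    by rewrite invfM; ring.
  rewrite ler_pdivrMr //.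
  have := ler_wpM2l (powR_ge0 2 (- (delta / 8 * n%:R))) BSs; apply: le_trans.
  apply: (@le_trans _ _ (D * (2 `^ (delta / 16 * n%:R) * 2 `^ (delta / 16 * n%:R)))).
    by rewrite ler_wpM2l // ler_pM ?exprn_ge0 ?addr_ge0 ?(ltW l0).
  rewrite /D -!powRD ?pnatr_eq0 ?implybT //; apply: ler_powR; first by rewrite ler1n.
  lra.
rewrite /powR pnatr_eq0 /= ler_expR.
have : nu * n%:R / C <= delta / 8 * n%:R * ln 2; last by lra.
apply: (@le_trans _ _ (n%:R / C)).
  by rewrite ler_wpM2r ?invr_ge0 ?(ltW C0) // ler_piMl // ltW.
rewrite ler_pdivrMr //.
rewrite [leRHS](_ : _ = delta / 8 * ln 2 * C * n%:R); last by ring.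
rewrite ler_peMl ?(ltW nR) //.
move: C1; rewrite ler_pdivrMr ?mulr_gt0 //; lra.
Qed.

End Average.

(** * Most directions *)

Unset Implicit Arguments.

Theorem theorem8 (R : realType) (beta delta : R)
    (beta_gt0 : 0 < beta) (delta_gt0 : 0 < delta) :
  exists C : R, 0 < C /\
    forall (n : nat) (B : {set sign_cube n}) (A : two_cube n),
      (0 < n)%N ->
      #|B|%:R = 2 `^ (beta * n%:R) :> R ->
      #|` [fset x in cube_points A |
             ~~ (mean_char_abs R B x <= (mu_C A C)%:E)%E] |%:R
        <= 2 `^ (n%:R * (1 - beta + delta)) :> R.
Proof.
(* With l ^+ 2 as the threshold of balanced bits, the loss (1 + l) ^+ (2 * n) in
   the entropy bounds is at most 2 `^ (delta / 8 * n). *)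
pose l : R := Num.min 1 (2 `^ (delta / 16) - 1).
have pow_gt1 : 1 < 2 `^ (delta / 16) :> R.
  rewrite /powR pnatr_eq0 /= expR_gt1 mulr_gt0 ?divr_gt0 //.
  by rewrite ln_gt0 // ltr1n.
have l01 : 0 < l <= 1.
  by rewrite /l lt_min ltr01 subr_gt0 pow_gt1 ge_min lexx.
have lpow : 1 + l <= 2 `^ (delta / 16) by rewrite -lerBrDl ge_min lexx orbT.
have /andP[l0 _] := l01.
have ln2 : 0 < ln 2 :> R by rewrite ln_gt0 // ltr1n.
have d20 : 0 < delta / 2 by rewrite divr_gt0.
have e0 : 0 < l ^+ 4 / 64 * (delta / 2) by rewrite mulr_gt0 ?divr_gt0 ?exprn_gt0.
(* c1 controls the pairs with few common free coordinates, c2 the large energies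
   in Halasz's inequality, and c3 the density delta / 2 of the free ones. *)
set c1 : R := 8 / (delta * ln 2).
set c2 : R := 16 / (l ^+ 4 / 64 * (delta / 2)).
set c3 : R := (delta / 2)^-1 ^+ 2 *
  (1 + 50 * 32 / Num.sqrt (l ^+ 4 / 64 * (delta / 2))).
have c1_gt0 : 0 < c1 by rewrite divr_gt0 ?mulr_gt0.
have c2_gt0 : 0 < c2 by rewrite divr_gt0.
have c3_gt0 : 0 < c3.
  have G0 : 0 <= 50 * 32 / Num.sqrt (l ^+ 4 / 64 * (delta / 2)).
    by rewrite divr_ge0 ?sqrtr_ge0 ?mulr_ge0 ?ler0n.
  by rewrite mulr_gt0 ?exprn_gt0 ?invr_gt0 // (lt_le_trans ltr01) // lerDl.
exists (c1 + c2 + c3); set C := c1 + c2 + c3.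
have C0 : 0 < C by rewrite /C; lra.
split=> // n B A n0 cardB; rewrite leNgt; apply/negP => manyE.
pose mean b : R := circle_mean (char_abs B (cube_vertex A b)).
pose S := [set b | ~~ (mean b <= mu_C A C)].
have B0 : (0 < #|B|)%N by rewrite -(ltr0n R) cardB powR_gt0.
have leS : 2 `^ (n%:R * (1 - beta + delta)) <= #|S|%:R :> R.
  apply: ltW; apply: lt_le_trans manyE _; rewrite ler_nat.
  have : (#|` [fset cube_vertex A b | b in S]| <= #|S|)%N.
    by rewrite cardE; exact: leq_imfset_card.
  apply: leq_trans.
  apply: fsubset_leq_card; apply/fsubsetP => x.
  rewrite !inE => /andP[/imfsetP[b _ ->]]; rewrite mean_char_absE lee_fin => bad.
  by apply/imfsetP; exists b => //; rewrite inE.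
have S0 : (0 < #|S|)%N.
  by rewrite -(ltr0n R); apply: lt_le_trans leS; rewrite powR_gt0.
have BS : 2 `^ (n%:R * (1 + delta)) <= #|B|%:R * #|S|%:R :> R.
  rewrite cardB (_ : n%:R * _ = beta * n%:R + n%:R * (1 - beta + delta)).
    by rewrite powRD ?pnatr_eq0 ?implybT // ler_wpM2l ?powR_ge0.
  by ring.
(* The infimum mu_C lies below finitely many means, so some admissible mu lies
   below all of them. *)
have /card_gt0P[b1 b1S] := S0.
have [b0 b0S b0min] := arg_minP mean b1S.
have mu_lt : mu_C A C < mean b0.
  by move: (b0S : b0 \in S); rewrite inE -ltNge.
have mean_le1 : mean b0 <= 1.
  rewrite -[leRHS](circle_mean_cst (1 : R)); apply: circle_mean_le.
  - exact: continuous_char_abs.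
  - exact: cst_continuous.
  - by move=> t _; exact: char_abs_le1.
move: mu_lt; rewrite /mu_C; case: asboolP => [mu0|_]; last first.
  by rewrite ltNge mean_le1.
move=> /(inf_lt mu0)[mu [/andP[mu_ge0 _] [nu [nu01 mu_nu]]] mu_lt].
have [C1 [C2 C3]] : c1 <= C /\ c2 <= C /\ c3 <= C by rewrite /C; lra.
have := @two_source_circle_mean R n A B S delta l nu C n0 delta_gt0 l01 lpow
  nu01 B0 S0 BS C1 C2 C3.
move=> /le_trans/(_ mu_nu); apply/negP; rewrite -ltNge.
have cS x : continuous (fun theta : R =>
    unif R S x * char_abs B (cube_vertex A x) theta).
  by apply: continuous_scale; exact: continuous_char_abs.
have [_ ->] := circle_mean_sum (index_enum _) cS.
have nu_gt0 : 0 < (1 + nu) ^+ 2.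
  by rewrite exprn_gt0 // addr_gt0 //; case/andP: nu01.
rewrite gt0_ltr_powR ?nnegrE //.
  apply: sumr_ge0 => x _; apply: circle_mean_ge0 => t.
  by rewrite mulr_ge0 ?unif_ge0 ?char_abs_ge0.
apply: lt_le_trans mu_lt _; rewrite -[leLHS]mul1r -(@sum_unif R _ S S0) mulr_suml.
apply: ler_sum => x _; rewrite circle_meanZ; last exact: continuous_char_abs.
have [xS|xS] := boolP (x \in S).
  by rewrite ler_wpM2l ?unif_ge0 // b0min.
by rewrite /unif (negbTE xS) !mul0r.
Qed.
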